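(* Let $N\ge 2$ and let $B$ be the open unit ball of $\mathbb{R}^N$. Let $a\in C^1([0,1],\mathbb{R})$ be nondecreasing with $a_0:=a(0)>0$, and suppose that $x\mapsto a(|x|)$ is nonconstant on $B$. Let $f\in C^1([0,+\infty),\mathbb{R})$ be nondecreasing with $f(0)=0$, $f'(0)=\lim_{s\to0^+}\frac{f(s)}{s}=0$ and $\liminf_{s\to+\infty}\frac{f(s)}{s}>\frac1{a_0}$. Then there exists at least one nonconstant radial solution $u$, nondecreasing as a function of $|x|$, of the problem $$-\Delta u+u=a(|x|)f(u)\ \text{ in } B,\qquad u>0\ \text{ in } B,\qquad \partial_\nu u=0\ \text{ on }\partial B.$$
   Context: $\nu$ denotes the outer unit normal on $\partial B$. A solution is a function $u\in H^2(B)$ satisfying the equation almost everywhere in $B$ and the Neumann boundary condition in the sense of traces. *)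

(* Defs.v *)
From HB Require Import structures.
From mathcomp Require Import all_boot all_order all_algebra.
From mathcomp Require Import all_classical all_reals all_analysis.
From mathcomp Require Import measurable_realfun.

Set Implicit Arguments.
Unset Strict Implicit.
Unset Printing Implicit Defensive.

Import Order.TTheory GRing.Theory Num.Theory.
Import numFieldNormedType.Exports.

Local Open Scope classical_set_scope.
Local Open Scope ring_scope.

(* R^n is 'rV[R]_n. The topology of 'rV[R]_n is the usual one, but the norm
   `|x| that the library puts on it is the sup norm: the Euclidean norm is
   enorm below. Since the library has no measure on 'rV[R]_n, the Borel
   sigma-algebra (generated by the coordinates) and the n-dimensional Lebesgue
   measure are built first. *)

Definition rV_display : measure_display.
Proof. exact: default_measure_display. Qed.

Section measurable_rV.
Context {R : realType} (n : nat).

Let coors : 'I_n -> 'rV[R]_n -> R := fun i x => x ord0 i.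

Let rV_set0 : g_sigma_preimage coors set0.
Proof. exact: sigma_algebra0. Qed.

Let rV_setC A : g_sigma_preimage coors A -> g_sigma_preimage coors (~` A).
Proof. exact: sigma_algebraC. Qed.

Let rV_bigcup (F : _^nat) : (forall i, g_sigma_preimage coors (F i)) ->
  g_sigma_preimage coors (\bigcup_i (F i)).
Proof. exact: sigma_algebra_bigcup. Qed.

HB.instance Definition _ := @isMeasurable.Build rV_display
  'rV[R]_n (g_sigma_preimage coors) rV_set0 rV_setC rV_bigcup.

End measurable_rV.

Section measurable_rV_theory.
Context {R : realType}.

Lemma measurable_coor n (i : 'I_n) :
  measurable_fun [set: 'rV[R]_n] (fun x : 'rV[R]_n => x ord0 i).
Proof.
move=> _ Y mY; rewrite setTI; apply: sub_sigma_algebra => /=.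
rewrite -bigcup_seq/=; exists i => /=; first by rewrite mem_index_enum.
by exists Y => //; rewrite setTI.
Qed.

Lemma measurable_fun_rVP d (T : measurableType d) n (f : T -> 'rV[R]_n) :
  (forall i, measurable_fun [set: T] (fun t => f t ord0 i)) ->
  measurable_fun [set: T] f.
Proof.
move=> mf.
have : g_sigma_preimage (fun i => (fun x : 'rV[R]_n => x ord0 i) \o f)
    `<=` measurable.
  apply: smallest_sub; first exact: sigma_algebra_measurable.
  case: n => [|n] in f mf *; first by rewrite big_ord0.
  rewrite -bigcup_mkord_ord; apply: bigcup_sub => i Ii.
  by move=> A [B mB <-]; exact: mf.
rewrite g_sigma_preimage_comp => prefS.
by move=> _ A mA; apply: prefS; exists A.
Qed.

End measurable_rV_theory.

Section lebesgue_rV.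
Context {R : realType}.

Definition rV_cons n (p : measurableTypeR R * 'rV[R]_n) : 'rV[R]_n.+1 :=
  \row_i if unlift ord0 i is Some j then p.2 ord0 j else p.1.

Definition rV_uncons n (x : 'rV[R]_n.+1) : measurableTypeR R * 'rV[R]_n :=
  (x ord0 ord0, \row_j x ord0 (lift ord0 j)).

Lemma rV_consK n : cancel (@rV_cons n) (@rV_uncons n).
Proof.
move=> [t x]; rewrite /rV_uncons /rV_cons mxE unlift_none; congr pair.
by apply/rowP => j; rewrite !mxE liftK.
Qed.

Lemma measurable_rV_cons n : measurable_fun setT (@rV_cons n).
Proof.
apply: measurable_fun_rVP => i; rewrite /rV_cons.
case: (unliftP ord0 i) => [j|] ->.
- rewrite (_ : (fun _ => _) = (fun x : 'rV[R]_n => x ord0 j) \o snd).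
    by apply: measurableT_comp => //; exact: measurable_coor.
  by apply/funext => p; rewrite mxE liftK.
- rewrite (_ : (fun _ => _) = fst); first exact: measurable_fst.
  by apply/funext => p; rewrite mxE unlift_none.
Qed.

Lemma measurable_rV_uncons n : measurable_fun setT (@rV_uncons n).
Proof.
apply: measurable_fun_pair; first exact: measurable_coor.
apply: measurable_fun_rVP => i; under eq_fun do rewrite mxE.
exact: measurable_coor.
Qed.

HB.instance Definition _ n :=
  isMeasurableFun.Build _ _ _ _ (@rV_cons n) (@measurable_rV_cons n).

Section lebesgue_rV_succ.
Variables (n : nat) (m : {sigma_finite_measure set 'rV[R]_n -> \bar R}).

Definition lebesgue_rV_succ : set 'rV[R]_n.+1 -> \bar R :=
  pushforward (lebesgue_measure \x m)%E (@rV_cons n).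

Let lebesgue_rV_succ0 : lebesgue_rV_succ set0 = 0%E.
Proof. exact: measure0. Qed.

Let lebesgue_rV_succ_ge0 A : (0 <= lebesgue_rV_succ A)%E.
Proof. exact: measure_ge0. Qed.

Let lebesgue_rV_succ_sigma_additive : semi_sigma_additive lebesgue_rV_succ.
Proof. exact: measure_semi_sigma_additive. Qed.

HB.instance Definition _ := isMeasure.Build _ _ _ lebesgue_rV_succ
  lebesgue_rV_succ0 lebesgue_rV_succ_ge0 lebesgue_rV_succ_sigma_additive.

Let lebesgue_rV_succ_sigma_finite : sigma_finite setT lebesgue_rV_succ.
Proof.
have /sigma_finiteP[F [FT ndF Foo]] := sigma_finiteT (@lebesgue_measure R).
have /sigma_finiteP[G [GT ndG Goo]] := sigma_finiteT m.
exists (fun k => @rV_uncons n @^-1` (F k `*` G k)).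
  apply/esym/seteqP; split => // x _.
  have [[k _ Fk] [l _ Gl]] : (\bigcup_i F i) (rV_uncons x).1 /\
      (\bigcup_i G i) (rV_uncons x).2 by rewrite -FT -GT.
  exists (maxn k l) => //; split => /=.
  - by move: Fk; exact/subsetPset/ndF/leq_maxl.
  - by move: Gl; exact/subsetPset/ndG/leq_maxr.
move=> k; have [mF Fk] := Foo k; have [mG Gk] := Goo k; split.
  rewrite -[X in measurable X]setTI; apply: measurable_rV_uncons => //.
  exact: measurableX.
rewrite /lebesgue_rV_succ /pushforward -comp_preimage.
rewrite (_ : _ \o _ = id); last by apply/funext => p; exact: rV_consK.
by rewrite preimage_id product_measure1E// lte_mul_pinfty// ge0_fin_numE.
Qed.

HB.instance Definition _ := Measure_isSigmaFinite.Build _ _ _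
  lebesgue_rV_succ lebesgue_rV_succ_sigma_finite.

End lebesgue_rV_succ.

(* Lebesgue measure on R^0 is the unit mass; on R^(n+1) it is the product of
   the Lebesgue measures of R and R^n. *)
Fixpoint lebesgue_rV (n : nat) : {sigma_finite_measure set 'rV[R]_n -> \bar R} :=
  if n is n'.+1 then lebesgue_rV_succ (lebesgue_rV n') else \d_(0 : 'rV[R]_0).

End lebesgue_rV.

Section euclidean.
Context {R : realType} {n : nat}.

Definition enorm (x : 'rV[R]_n) : R := Num.sqrt (\sum_i x ord0 i ^+ 2).

Definition unit_ball : set 'rV[R]_n := [set x | enorm x < 1].

Definition unit_cball : set 'rV[R]_n := [set x | enorm x <= 1].

Definition unit_sphere : set 'rV[R]_n := [set x | enorm x = 1].

Lemma measurable_enorm : measurable_fun setT enorm.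
Proof.
rewrite (_ : enorm = (@powR R ^~ 2^-1) \o (fun x : 'rV[R]_n => \sum_i x ord0 i ^+ 2)).
  apply: (measurableT_comp (measurable_powR _)).
  apply: measurable_sum => i; apply: measurable_funX; exact: measurable_coor.
apply/funext => x; rewrite /= powR12_sqrt// sumr_ge0// => i _.
exact: sqr_ge0.
Qed.

Lemma measurable_unit_ball : measurable unit_ball.
Proof.
rewrite (_ : unit_ball = enorm @^-1` `]-oo, 1[).
  rewrite -[X in measurable X]setTI; exact: measurable_enorm.
by apply/seteqP; split => x; rewrite /unit_ball /= in_itv.
Qed.

Definition radial_proj (x : 'rV[R]_n) : 'rV[R]_n := (enorm x)^-1 *: x.

Lemma measurable_radial_proj : measurable_fun setT radial_proj.
Proof.
apply: measurable_fun_rVP => i; under eq_fun do rewrite mxE.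
apply: measurable_funM; last exact: measurable_coor.
rewrite (_ : (fun _ => _) = (@powR R ^~ (-1)) \o enorm).
  apply: (measurableT_comp (measurable_powR _)); exact: measurable_enorm.
by apply/funext => x; rewrite /= powR_inv1// sqrtr_ge0.
Qed.

HB.instance Definition _ :=
  isMeasurableFun.Build _ _ _ _ radial_proj measurable_radial_proj.

Definition cone_measure : set 'rV[R]_n -> \bar R :=
  pushforward (mrestr (lebesgue_rV n) measurable_unit_ball) radial_proj.

Let cone_measure0 : cone_measure set0 = 0%E.
Proof. exact: measure0. Qed.

Let cone_measure_ge0 A : (0 <= cone_measure A)%E.
Proof. exact: measure_ge0. Qed.

Let cone_measure_sigma_additive : semi_sigma_additive cone_measure.
Proof. exact: measure_semi_sigma_additive. Qed.

HB.instance Definition _ := isMeasure.Build _ _ _ cone_measure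
  cone_measure0 cone_measure_ge0 cone_measure_sigma_additive.

End euclidean.

(* Surface measure of the unit sphere, by the cone formula
   sigma(E) = n * |{x in B : x / |x| in E}|. *)
Definition surface_measure {R : realType} {n : nat} : {measure set 'rV[R]_n -> \bar R} :=
  mscale n%:R%:nng cone_measure.

Arguments unit_ball {R n}.
Arguments unit_cball {R n}.
Arguments unit_sphere {R n}.

Section sobolev.
Context {R : realType} {n : nat}.
Local Notation E := 'rV[R]_n.

Definition sq_norm (m : set E -> \bar R) (D : set E) (v : E -> R) : \bar R :=
  (\int[m]_(x in D) (v x ^+ 2)%:E)%E.

Definition L2 (m : set E -> \bar R) (D : set E) (v : E -> R) : Prop :=
  measurable_fun D v /\ (sq_norm m D v < +oo)%E.

Definition partial (i : 'I_n) (phi : E -> R) : E -> R :=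
  'D_(delta_mx ord0 i) phi.

Fixpoint Ck (k : nat) (phi : E -> R) : Prop :=
  continuous phi /\
  if k is k'.+1 then
    (forall i x, derivable phi x (delta_mx ord0 i)) /\
    (forall i, Ck k' (partial i phi))
  else True.

(* C_c^infty(B) *)
Definition test_function (phi : E -> R) : Prop :=
  [/\ forall k, Ck k phi,
      compact (closure [set x | phi x != 0]) &
      closure [set x | phi x != 0] `<=` unit_ball].

(* dv is the weak i-th partial derivative of v in B *)
Definition weak_partial (i : 'I_n) (v dv : E -> R) : Prop :=
  forall phi, test_function phi ->
    \int[lebesgue_rV n]_(x in unit_ball) (v x * partial i phi x) =
    - \int[lebesgue_rV n]_(x in unit_ball) (dv x * phi x).

(* v is in H^1(B), with weak gradient dv *)
Definition H1 (v : E -> R) (dv : 'I_n -> E -> R) : Prop :=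
  L2 (lebesgue_rV n) unit_ball v /\
  forall i, L2 (lebesgue_rV n) unit_ball (dv i) /\ weak_partial i v (dv i).

(* u is in H^2(B), with weak gradient du and weak Hessian d2u *)
Definition H2 (u : E -> R) (du : 'I_n -> E -> R) (d2u : 'I_n -> 'I_n -> E -> R)
    : Prop :=
  H1 u du /\ forall i, H1 (du i) (d2u i).

(* t is the trace on the unit sphere of v in H^1(B): the trace operator is the
   continuous extension to H^1(B) of the restriction map on the functions of
   H^1(B) that are continuous on the closed ball. *)
Definition trace (v : E -> R) (dv : 'I_n -> E -> R) (t : E -> R) : Prop :=
  L2 surface_measure unit_sphere t /\
  exists (w : nat -> E -> R) (dw : nat -> 'I_n -> E -> R),
    [/\ forall k, {within unit_cball, continuous (w k)} /\ H1 (w k) (dw k),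
        sq_norm (lebesgue_rV n) unit_ball (w k \- v) @[k --> \oo] --> 0%E,
        forall i, sq_norm (lebesgue_rV n) unit_ball (dw k i \- dv i)
                    @[k --> \oo] --> 0%E &
        sq_norm surface_measure unit_sphere (w k \- t) @[k --> \oo] --> 0%E].

(* The outer unit normal at a point x of the unit sphere is x itself. *)
Definition neumann (du : 'I_n -> E -> R) (d2u : 'I_n -> 'I_n -> E -> R)
    : Prop :=
  exists t : 'I_n -> E -> R, (forall i, trace (du i) (d2u i) (t i)) /\
    {ae surface_measure, forall x,
      unit_sphere x -> \sum_i x ord0 i * t i x = 0}.

Definition solution (a f : R -> R) (u : E -> R) : Prop :=
  exists (du : 'I_n -> E -> R) (d2u : 'I_n -> 'I_n -> E -> R),
    [/\ H2 u du d2u,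
        {ae lebesgue_rV n, forall x, unit_ball x ->
          - (\sum_i d2u i i x) + u x = a (enorm x) * f (u x)},
        forall x, unit_ball x -> 0 < u x &
        neumann du d2u].

(* Constant up to a null set: H^2(B) consists of classes of functions. *)
Definition ae_constant (u : E -> R) : Prop :=
  exists c, {ae lebesgue_rV n, forall x, unit_ball x -> u x = c}.

Definition radial_nondecreasing (u : E -> R) : Prop :=
  exists U : R -> R, {in `[0, 1[ &, {homo U : r s / r <= s}} /\
    forall x, unit_ball x -> u x = U (enorm x).

End sobolev.

(* f is C^1 on A; the derivative is one-sided at the endpoints that are in A *)
Definition C1_on {R : realType} (A : set R) (f : R -> R) : Prop :=
  exists df : R -> R, {within A, continuous df} /\
    forall x, A x -> (f y - f x) / (y - x) @[y --> within A x^'] --> df x.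

(* Main.v *)
Require Import Defs.
From mathcomp Require Import all_boot all_order all_algebra.
From mathcomp Require Import all_classical all_reals all_analysis.
From mathcomp Require Import measurable_realfun ring lra.

Set Implicit Arguments.
Unset Strict Implicit.
Unset Printing Implicit Defensive.

Import Order.TTheory GRing.Theory Num.Theory.
Import numFieldNormedType.Exports.

Local Open Scope classical_set_scope.
Local Open Scope ring_scope.

(* Shooting. Writing u(x) = U(|x|) and V = U'/r, the equation reads
   (r^N V)' = r^(N-1) (U - a(r) f(U)), with U(0) = d as the shooting parameter,
   and the boundary condition is V(1) = 0. As any positive solution is
   nonconstant, it suffices to find d > 0 with V(1) = 0 and V >= 0 on [0, 1].
   For d small, V > 0 on [0, 1], because f(s) = o(s); if a(0) f(d) > d, as for
   some large d, then V(0) < 0. Let d be the supremum of the (bounded) set of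
   parameters for which V > 0 on [0, 1]. Then V >= 0 for d, and V has a zero r0,
   the set being open. A zero r0 < 1 is impossible: a Gronwall argument, run
   backwards from r0 and then forwards, would make U constant on [0, 1], and
   then a(|x|) would be constant on the ball. So V(1) = 0.
   The resulting u is C^2 on the whole space when a and f are extended by
   constants, so that the weak derivatives and the traces are the classical
   ones. *)

(** * Primitives and radial averages *)

(** The unknown [V] = U'/r is preferred to U' because it stays continuous at r = 0, where the
    equation fixes its value, and because the gradient of u is V(|x|) x. Monotonicity makes both
    Gronwall inequalities linear. While V >= 0, U is nondecreasing, hence so is a(r) f(U). If the
    source U - a f(U) vanishes at r0, then on (s, r0) it is at least U(s) - U(r0); if it is <= 0 at
    0, then it is at most U - U(0) afterwards. The second remark also shows that V >= 0 on [0, 1]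
    forces a(0) f(d) < d. So the supremum d differs from the bound M, chosen with M < a(0) f(M), and
    there is room to increase d as long as V > 0. Truncating f makes the source globally Lipschitz,
    so that solutions exist on the whole half-line and depend on d in a Lipschitz way. The bound U
    <= 2 d exp(r^2) uses only a f >= 0, which allows the truncation level to be fixed in advance. *)

Section calculus.
Context {R : realType}.
Implicit Types (f g h : R -> R).

Lemma near_is_derive f g (x df : R) :
  {near x, f =1 g} -> is_derive x 1 f df -> is_derive x 1 g df.
Proof.
move=> fg [dfx <-]; split.
- by apply: (near_eq_derivable _ dfx).
- by apply/esym; apply: near_eq_derive.
Qed.

Lemma is_derive_continuous f (df : R -> R) :
  (forall x : R, is_derive x 1 f (df x)) -> continuous f.
Proof.
move=> dfx x; apply: differentiable_continuous; apply/derivable1_diffP.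
exact: (@ex_derive _ _ _ _ _ _ _ (dfx x)).
Qed.

Lemma is_derive_mull (c x : R) : is_derive x 1 (fun s : R => c * s) c.
Proof.
have := @is_deriveZ _ _ _ id c x 1 1 (is_derive_id _ _).
by move/is_derive_eq; apply; exact: mulr1.
Qed.

Lemma is_derive_exprS n (x : R) :
  is_derive x 1 (fun s : R => s ^+ n.+1) (n.+1%:R * x ^+ n).
Proof. by split; [exact: exprn_derivable|rewrite -derive1E exp_derive1]. Qed.

Lemma bounded_within_itv f (a b : R) : {within `[a, b], continuous f} ->
  exists C : R, forall t : R, a <= t <= b -> `|f t| <= C.
Proof.
move=> cf.
have [C [_ /(_ (C + 1))]] := @compact_bounded R _ _
  (continuous_compact cf (@segment_compact R a b)).
rewrite ltrDl ltr01 => /(_ isT) H.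
by exists (C + 1) => t tab; apply: H; exists t => //=; rewrite in_itv.
Qed.

Lemma continuous_mul (T : topologicalType) (u v : T -> R) :
  continuous u -> continuous v -> continuous (fun x => u x * v x).
Proof. by move=> cu cv x; exact: (cvgM (cu x) (cv x)). Qed.

Lemma continuous_add (T : topologicalType) (u v : T -> R) :
  continuous u -> continuous v -> continuous (fun x => u x + v x).
Proof. by move=> cu cv x; exact: (cvgD (cu x) (cv x)). Qed.

(** The mean value theorem for [g - f]. Derivatives are asked for in the open interval only: the
    radial equations hold for [r > 0], and at [0] only continuity is at hand. *)
Lemma derivative_le f g df dg (a b : R) : a <= b ->
  continuous f -> continuous g ->
  (forall x, a < x < b -> is_derive x 1 f (df x)) ->
  (forall x, a < x < b -> is_derive x 1 g (dg x)) ->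
  (forall x, a < x < b -> df x <= dg x) ->
  f b - f a <= g b - g a.
Proof.
rewrite le_eqVlt => /predU1P[-> *|ab cf cg dfx dgx dfg]; first by rewrite !subrr.
have cgf : continuous (g - f) by move=> x; apply: cvgB; [exact: cg|exact: cf].
have [x||c cab /eqP] := @MVT R (g - f) (dg - df) a b ab.
- by rewrite in_itv/= => xab; apply: is_deriveB; [exact: dgx|exact: dfx].
- exact: continuous_subspaceT.
- move: cab; rewrite in_itv/= => cab.
  rewrite -subr_ge0 => /eqP; rewrite !fctE => E.
  have -> : g b - g a - (f b - f a) = g b - f b - (g a - f a) by ring.
  by rewrite E mulr_ge0 ?subr_ge0 ?dfg// ltW.
Qed.

Definition primitive h (x : R) : R :=
  \int[@lebesgue_measure R]_(t in `[0, x]) h t.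

Lemma primitive_le0 h (x : R) : x <= 0 -> primitive h x = 0.
Proof.
rewrite le_eqVlt => /predU1P[->|x0]; rewrite /primitive.
  by rewrite set_itv1 Rintegral_set1.
by rewrite set_itv_ge ?Rintegral_set0// -leNgt bnd_simp.
Qed.

Let integrable_cc h (a b : R) : continuous h ->
  (@lebesgue_measure R).-integrable `[a, b] (EFin \o h).
Proof.
move=> ch; apply: continuous_compact_integrable; first exact: segment_compact.
exact: continuous_subspaceT.
Qed.

Lemma is_derive_primitive h (x : R) : continuous h -> 0 < x ->
  is_derive x 1 (primitive h) (h x).
Proof.
move=> ch x0.
have xx1 : x < x + 1 by rewrite ltrDl.
have [|d1 d2] := @continuous_FTC1_closed R h 0 x (x + 1) xx1 _ x0 (ch x).
  exact: integrable_cc.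
by split; [exact: d1|rewrite -derive1E; exact: d2].
Qed.

Lemma continuous_primitive h : continuous h -> continuous (primitive h).
Proof.
move=> ch x; have [x0|x0|->] := ltgtP x 0.
- have : {near x, (fun=> 0) =1 primitive h}.
    near=> y; rewrite primitive_le0//.
    by apply: ltW; near: y; exact: lt_nbhsl.
  move=> /near_eq_cvg H; rewrite /continuous_at primitive_le0 ?ltW//.
  by apply: (cvg_trans H); exact: cvg_cst.
- apply: differentiable_continuous; apply/derivable1_diffP.
  exact: (@ex_derive _ _ _ _ _ _ _ (is_derive_primitive ch x0)).
- rewrite /continuous_at primitive_le0//.
  have H := @parameterized_integral_cvg_left R 0 1 h ltr01 (@integrable_cc h 0 1 ch).
  exact: H.
Unshelve. all: by end_near. Qed.

(** The continuous solution [V] of (r^(n+1) V)' = r^n h, that is, 1/(n+1) times the mean of the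
    radial function h(|x|) over the ball of radius r in dimension n+1. For [r <= 0] it takes its
    limit at 0, so that it is continuous on the whole line. *)
Definition radial_average n h (r : R) : R :=
  if r <= 0 then h 0 / n.+1%:R
  else primitive (fun t => t ^+ n * h t) r / r ^+ n.+1.

Let continuous_Xn n : continuous (fun t : R => t ^+ n).
Proof. by move=> x; exact: exprn_continuous. Qed.

Let continuous_Xnh n h : continuous h -> continuous (fun t : R => t ^+ n * h t).
Proof. by move=> ch x; apply: cvgM; [exact: continuous_Xn|exact: ch]. Qed.

Lemma radial_average0 n h : radial_average n h 0 = h 0 / n.+1%:R.
Proof. by rewrite /radial_average lexx. Qed.

Lemma is_derive_radial_average n h (r : R) : continuous h -> 0 < r ->
  is_derive r 1 (fun s => s ^+ n.+1 * radial_average n h s) (r ^+ n * h r).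
Proof.
move=> ch r0.
have := is_derive_primitive (@continuous_Xnh n h ch) r0.
apply: near_is_derive; near=> s.
have s0 : 0 < s by near: s; exact: lt_nbhsr.
by rewrite /radial_average leNgt s0/= mulrC divfK// expf_neq0// gt_eqF.
Unshelve. all: by end_near. Qed.

Lemma continuous_radial_average n h :
  continuous h -> continuous (radial_average n h).
Proof.
move=> ch x; have [x0|x0|->] := ltgtP x 0.
- have : {near x, (fun=> h 0 / n.+1%:R) =1 radial_average n h}.
    near=> y; rewrite /radial_average ifT//.
    by apply: ltW; near: y; exact: lt_nbhsl.
  move=> /near_eq_cvg H; rewrite /continuous_at {2}/radial_average (ltW x0).
  by apply: (cvg_trans H); exact: cvg_cst.
- have : {near x, (fun r => primitive (fun t => t ^+ n * h t) r / r ^+ n.+1)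
               =1 radial_average n h}.
    near=> y; rewrite /radial_average leNgt ifF//.
    by apply/negbTE; rewrite negbK; near: y; exact: lt_nbhsr.
  move=> /near_eq_cvg H; rewrite /continuous_at {2}/radial_average leNgt x0/=.
  apply: (cvg_trans H); apply: cvgM.
    exact: continuous_primitive (@continuous_Xnh n h ch) _.
  apply: cvgV; last exact: continuous_Xn.
  by rewrite expf_neq0// gt_eqF.
- apply/left_right_continuousP; split; rewrite /= radial_average0.
    apply: (@cvg_trans _ ((fun=> h 0 / n.+1%:R : R) @ 0^'-)); last exact: cvg_cst.
    apply: near_eq_cvg; near=> y.
    by rewrite /radial_average ifT// ltW.
  apply: (@cvg_trans _
    ((fun r => primitive (fun t => t ^+ n * h t) r / r ^+ n.+1) @ 0^'+)).
    apply: near_eq_cvg; near=> y.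
    by rewrite /radial_average leNgt ifF//; apply/negbTE; rewrite negbK.
  (* The limit at 0 has the form 0/0; the quotient of the derivatives is [h r / n.+1%:R]. *)
  apply: (@lhopital_at_right R _ (fun t => t ^+ n * h t) _
    (fun t => n.+1%:R * t ^+ n) 0 1) => //.
  + move=> y; rewrite in_itv/= => /andP[y0 _].
    exact: is_derive_primitive (@continuous_Xnh n h ch) y0.
  + by move=> y _; exact: is_derive_exprS.
  + rewrite -[X in _ --> X](@primitive_le0 (fun t => t ^+ n * h t) 0 (lexx _)).
    apply: cvg_at_right_filter.
    exact: continuous_primitive (@continuous_Xnh n h ch) _.
  + rewrite [X in _ --> X](_ : 0 = 0 ^+ n.+1); last by rewrite expr0n.
    apply: cvg_at_right_filter; exact: continuous_Xn.
  + by move=> y; rewrite in_itv/= => /andP[y0 _]; rewrite mulf_neq0// expf_neq0// gt_eqF.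
  + apply: (@cvg_trans _ ((fun r => h r / n.+1%:R) @ 0^'+)).
      apply: near_eq_cvg; near=> y.
      have y0 : y != 0 by rewrite gt_eqF.
      by rewrite [y ^+ n * _]mulrC -mulf_div divff ?mulr1// expf_neq0.
    by apply: cvg_at_right_filter; apply: cvgM; [exact: ch|exact: cvg_cst].
Unshelve. all: by end_near. Qed.

End calculus.

(** * Radial systems and comparison *)

Section radial_system.
Context {R : realType}.
Implicit Types (h U V : R -> R).

(* The equation [U'' + n/r U' = h] in dimension [n + 1], with [V = U' / r]. It
   is imposed for [r > 0] only; the solutions built below are constant on
   [r <= 0]. *)
Definition radial_system n h U V :=
  [/\ continuous U, continuous V, V 0 = h 0 / n.+1%:R,
      forall r : R, 0 < r -> is_derive r 1 U (r * V r) &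
      forall r : R, 0 < r ->
        is_derive r 1 (fun s => s ^+ n.+1 * V s) (r ^+ n * h r)].

Definition radial_solve n (d : R) h (r : R) : R :=
  d + primitive (fun s => s * radial_average n h s) r.

Lemma radial_solve_le0 n d h r : r <= 0 -> radial_solve n d h r = d.
Proof. by move=> r0; rewrite /radial_solve primitive_le0// addr0. Qed.

Lemma radial_solveP n d h : continuous h ->
  radial_system n h (radial_solve n d h) (radial_average n h).
Proof.
move=> ch.
have ca := @continuous_radial_average R n h ch.
have cia : continuous (fun s : R => s * radial_average n h s).
  by move=> x; apply: cvgM; [exact: cvg_id|exact: ca].
split => //.
- move=> x; apply: cvgD; first exact: cvg_cst.
  exact: continuous_primitive.
- exact: radial_average0.
- move=> r r0; have dp := is_derive_primitive cia r0.
  have := @is_deriveD _ _ _ (cst d) _ r 1 0 _ (is_derive_cst _ _ _) dp.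
  by rewrite add0r.
- by move=> r r0; exact: is_derive_radial_average.
Qed.

Lemma radial_systemB n h1 U1 V1 h2 U2 V2 :
  radial_system n h1 U1 V1 -> radial_system n h2 U2 V2 ->
  radial_system n (h1 \- h2) (U1 \- U2) (V1 \- V2).
Proof.
move=> [cU1 cV1 V10 dU1 dV1] [cU2 cV2 V20 dU2 dV2]; split.
- by move=> x; apply: cvgB; [exact: cU1|exact: cU2].
- by move=> x; apply: cvgB; [exact: cV1|exact: cV2].
- by rewrite /= V10 V20 mulrBl.
- move=> r r0; have := is_deriveB (dU1 r r0) (dU2 r r0).
  by rewrite /= mulrBr.
- move=> r r0; have := is_deriveB (dV1 r r0) (dV2 r r0).
  rewrite /= mulrBr; congr is_derive.
  by apply/funext => s; rewrite !fctE mulrBr.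
Qed.

(** Subtracting this system turns a bound on [U] into one on [U - U 0]. It also compares the first
    two Picard iterates. *)
Lemma radial_system_cst n (d : R) : radial_system n (cst 0) (cst d) (cst 0).
Proof.
split.
- by move=> x; exact: cvg_cst.
- by move=> x; exact: cvg_cst.
- by rewrite /= mul0r.
- by move=> r r0; rewrite /= mulr0; exact: is_derive_cst.
- move=> r r0; rewrite /= mulr0.
  rewrite (_ : (fun _ => _) = cst 0); first exact: is_derive_cst.
  by apply/funext => s; rewrite /= mulr0.
Qed.

(** A Bielecki weight: for a source that is [L]-Lipschitz in the unknown, the solution operator
    halves distances in the norm sup |u| / w, on intervals of any length. The square in the exponent
    fits U' = r V. *)
Definition weight (L r : R) : R := expR (L * r ^+ 2).

Lemma weight_gt0 (L r : R) : 0 < weight L r. Proof. exact: expR_gt0. Qed.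

Lemma weight_ge1 (L r : R) : 0 <= L -> 1 <= weight L r.
Proof.
by move=> L0; rewrite -expR0 ler_expR mulr_ge0// sqr_ge0.
Qed.

Lemma weight0 (L : R) : weight L 0 = 1.
Proof. by rewrite /weight expr0n/= mulr0 expR0. Qed.

Lemma is_derive_weight (L r : R) : is_derive r 1 (weight L) (2 * L * r * weight L r).
Proof.
have d2 : is_derive r 1 (fun s : R => L * s ^+ 2) (L * (2 * r)).
  exact: is_deriveZ (is_derive_exprS 1 r).
have := @is_derive1_comp R expR (fun s : R => L * s ^+ 2) r _ _ (is_derive_expR _) d2.
move/is_derive_eq; apply.
by rewrite -/(weight L r) mulrC; ring.
Qed.

Lemma continuous_weight (L : R) : continuous (weight L).
Proof. exact: is_derive_continuous (is_derive_weight L). Qed.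

(* Barrier: [K * weight L] has derivative [r * (2 * L * K * weight L r)]. *)
Lemma radial_le n h U V (L K b : R) : 0 < L -> 0 <= K ->
  radial_system n h U V ->
  (forall r : R, 0 <= r <= b -> h r <= 2 * L * K * weight L r) ->
  forall r : R, 0 <= r <= b ->
    U r <= U 0 + K * weight L r /\ V r <= 2 * L * K * weight L r.
Proof.
move=> L0 K0 [cU cV V0 dU dV] hle.
have L2K : 0 <= 2 * L * K by rewrite !mulr_ge0// ltW.
have Vle r : 0 <= r <= b -> V r <= 2 * L * K * weight L r.
  move=> /andP[]; rewrite le_eqVlt => /predU1P[<- b0|r0 rb].
    have := hle 0; rewrite lexx b0 weight0 => /(_ isT) h0.
    rewrite V0 ler_pdivrMr// (le_trans h0)// ler_peMr//.
      by rewrite mulr1.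
    by rewrite ler1n.
  have rn0 : 0 < r ^+ n.+1 by rewrite exprn_gt0.
  rewrite -(ler_pM2l rn0).
  have := @derivative_le R (fun s => s ^+ n.+1 * V s)
    (fun s => s ^+ n.+1 * (2 * L * K * weight L s))
    (fun s => s ^+ n * h s)
    (fun s => n.+1%:R * s ^+ n * (2 * L * K * weight L s) +
       s ^+ n.+1 * (2 * L * K * (2 * L * s * weight L s))) 0 r (ltW r0).
  rewrite !expr0n/= !mul0r !subr0; apply.
  - by move=> x; apply: cvgM; [exact: exprn_continuous|exact: cV].
  - move=> x; apply: cvgM; first exact: exprn_continuous.
    by apply: cvgM; [exact: cvg_cst|exact: continuous_weight].
  - by move=> x /andP[x0 _]; exact: dV.
  - move=> x _.
    have dw := @is_deriveZ _ _ _ (weight L) (2 * L * K) x 1 _ (is_derive_weight L x).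
    have := is_deriveM (is_derive_exprS n x) dw; move=> /is_derive_eq; apply.
    rewrite addrC; congr (_ + _); exact: mulrC.
  - move=> x /andP[x0 xr].
    have hx : h x <= 2 * L * K * weight L x.
      by apply: hle; rewrite ltW//= (le_trans (ltW xr)).
    have xn : 0 <= x ^+ n by rewrite exprn_ge0// ltW.
    have W0 := ltW (weight_gt0 L x).
    have LW0 : 0 <= 2 * L * K * weight L x by rewrite mulr_ge0.
    rewrite (le_trans (ler_wpM2l xn hx))//.
    (* Of the two nonnegative terms in the derivative of the barrier, the first is enough, because
       [1 <= n.+1]. *)
    apply: (@le_trans _ _ (n.+1%:R * x ^+ n * (2 * L * K * weight L x))).
      by rewrite -[leRHS]mulrA ler_peMl ?ler1n// mulr_ge0.
    rewrite lerDl !mulr_ge0 ?exprn_ge0//; exact: ltW.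
move=> r rb; split; last exact: Vle.
case/andP: rb => r0 rb.
have := @derivative_le R U (fun s => K * weight L s)
    (fun s => s * V s) (fun s => K * (2 * L * s * weight L s)) 0 r r0.
rewrite weight0 mulr1 => H.
suff : U r - U 0 <= K * weight L r - K by lra.
apply: H => //.
- by move=> x; apply: cvgM; [exact: cvg_cst|exact: continuous_weight].
- by move=> x /andP[x0 _]; exact: dU.
- move=> x _.
  exact: (@is_deriveZ _ _ _ (weight L) K x 1 _ (is_derive_weight L x)).
- move=> x /andP[x0 xr].
  have : V x <= 2 * L * K * weight L x.
    by apply: Vle; rewrite ltW//= (le_trans (ltW xr)).
  move=> /(ler_wpM2l (ltW x0)) /le_trans; apply.
  by rewrite [leLHS](_ : _ = K * (2 * L * x * weight L x)); last by ring.
Qed.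

Lemma radial_dist_le n h1 U1 V1 h2 U2 V2 (L K b : R) : 0 < L -> 0 <= K ->
  radial_system n h1 U1 V1 -> radial_system n h2 U2 V2 ->
  (forall r : R, 0 <= r <= b -> `|h1 r - h2 r| <= 2 * L * K * weight L r) ->
  forall r : R, 0 <= r <= b ->
    `|U1 r - U2 r| <= `|U1 0 - U2 0| + K * weight L r /\
    `|V1 r - V2 r| <= 2 * L * K * weight L r.
Proof.
move=> L0 K0 S1 S2 hle r rb.
have [|Ur Vr] := radial_le L0 K0 (radial_systemB S1 S2) _ rb.
  by move=> s /hle; rewrite ler_norml => /andP[].
have [|Ur' Vr'] := radial_le L0 K0 (radial_systemB S2 S1) _ rb.
  by move=> s /hle; rewrite distrC ler_norml => /andP[].
have [u1 u2] : U1 0 - U2 0 <= `|U1 0 - U2 0| /\ U2 0 - U1 0 <= `|U1 0 - U2 0|.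
  by split; [|rewrite distrC]; exact: ler_norm.
rewrite /= in Ur Vr Ur' Vr'.
split; rewrite ler_norml; apply/andP; split; lra.
Qed.

(** Let M be the maximum of [U / weight L], attained at c, and suppose M > 0. The source is at most
    L M w, so [radial_le] with K = M/2 gives M w(c) <= U(0) + M w(c)/2, whence M <= 2 U(0) as w >=
    1. In particular [U 0 <= 0] implies [U <= 0], which is the form used against constants. *)
Lemma radial_gronwall n h U V (L b : R) : 0 < L ->
  radial_system n h U V ->
  (forall r : R, 0 <= r <= b -> h r <= L * Num.max 0 (U r)) ->
  forall r : R, 0 <= r <= b -> U r <= 2 * Num.max 0 (U 0) * weight L r.
Proof.
move=> L0 S hle r /andP[r0 rb].
have [cU _ _ _ _] := S.
have b0 : 0 <= b by exact: le_trans rb.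
have cUw : {within `[0, b], continuous (fun s => U s / weight L s)}.
  apply: continuous_subspaceT => x; apply: cvgM; first exact: cU.
  apply: cvgV; first by rewrite gt_eqF// weight_gt0.
  exact: continuous_weight.
have [c] := EVT_max b0 cUw; rewrite in_itv/= => c0b cmax.
set M := Num.max 0 (U c / weight L c).
have M0 : 0 <= M by rewrite le_max lexx.
have UM s : 0 <= s <= b -> U s <= M * weight L s.
  move=> sb; rewrite -ler_pdivrMr ?weight_gt0//.
  by rewrite (le_trans (cmax s _)) ?in_itv//= le_max lexx orbT.
have M20 : 0 <= M / 2 by rewrite divr_ge0.
have hM s : 0 <= s <= b -> h s <= 2 * L * (M / 2) * weight L s.
  move=> sb; rewrite (le_trans (hle s sb))//.
  rewrite [leRHS](_ : _ = L * (M * weight L s)); last by field.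
  rewrite ler_pM2l// ge_max UM// andbT mulr_ge0//; exact/ltW/weight_gt0.
have [Uc _] := radial_le L0 M20 S hM c0b.
have Ml : M <= 2 * Num.max 0 (U 0).
  have [/eqP|M1] := eqVneq M 0.
    by move=> /eqP ->; rewrite mulr_ge0// le_max lexx.
  have Mgt : 0 < M by rewrite lt_def M1.
  have ME : M = U c / weight L c.
    by move: Mgt; rewrite /M; case: (leP 0 (U c / weight L c)) => //; rewrite ltxx.
  have UcE : U c = M * weight L c by rewrite ME divfK// gt_eqF// weight_gt0.
  have W1 : 1 <= weight L c by apply: weight_ge1; exact: ltW.
  have U0 : U 0 <= Num.max 0 (U 0) by rewrite le_max lexx orbT.
  have : M <= M * weight L c by rewrite ler_peMr.
  have : M * weight L c <= U 0 + M / 2 * weight L c by rewrite -UcE.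
  have -> : M / 2 * weight L c = M * weight L c / 2 by field.
  move: U0; move: (M * weight L c) (Num.max 0 (U 0)) => A B; lra.
rewrite (le_trans (UM r _)) ?r0//.
by rewrite ler_wpM2r// ltW// weight_gt0.
Qed.

End radial_system.

(** * Existence and continuous dependence *)

Section picard.
Context {R : realType}.

Lemma le_of_le_add_geometric (x y b : R) :
  (forall k, x <= y + b * 2^-1 ^+ k) -> x <= y.
Proof.
move=> H; rewrite leNgt; apply/negP => yx.
have e0 : 0 < x - y by rewrite subr_gt0.
pose k := Num.bound (b / (x - y)).
have bk : b / (x - y) < 2 ^+ k.
  have [b0|b0] := leP 0 (b / (x - y)).
    rewrite (lt_le_trans (archi_boundP b0))// -natrX ler_nat -/k.
    exact/ltnW/ltn_expl.
  by rewrite (lt_le_trans b0)// exprn_ge0.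
have := H k; rewrite exprVn leNgt => /negP; apply.
by rewrite -ltrBrDl ltr_pdivrMr ?exprn_gt0// mulrC -ltr_pdivrMr.
Qed.

Lemma dist_le3 (a b c d x y z : R) : `|a - b| <= x -> `|b - c| <= y ->
  `|c - d| <= z -> `|a - d| <= x + y + z.
Proof.
move=> ab bc cd; rewrite (le_trans (ler_distD c _ _))// lerD//.
by rewrite (le_trans (ler_distD b _ _))// lerD.
Qed.

(** The convergence is only locally uniform: continuity of [B] bounds it by [B x + 1] near [x], and
    an e/3 argument follows. *)
Lemma continuous_geometric_limit (p : nat -> R -> R) (u B : R -> R) :
  (forall k, continuous (p k)) -> continuous B ->
  (forall k r, `|u r - p k r| <= B r * 2^-1 ^+ k) -> continuous u.
Proof.
move=> cp cB pu x; apply/cvgrPdist_le => e e0.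
have [k Bk] : exists k, (B x + 1) * 2^-1 ^+ k <= e / 3.
  apply/not_existsP => H; suff : e / 3 <= 0 by lra.
  apply: (@le_of_le_add_geometric _ _ (B x + 1)) => k.
  by rewrite add0r ltW// ltNge; apply/negP/H.
have B0 y : 0 <= B y.
  by have := pu 0%N y; rewrite expr0 mulr1; exact: le_trans.
have q0 : 0 <= (2^-1 : R) ^+ k by rewrite exprn_ge0// invr_ge0.
have e3 : 0 < e / 3 by rewrite divr_gt0.
near=> y.
have puy : `|u y - p k y| <= e / 3.
  rewrite (le_trans (pu k y))// (le_trans _ Bk)// ler_wpM2r//.
  near: y; have := cB x; move=> /cvgrPdist_le/(_ 1 ltr01).
  apply: filterS => y; rewrite distrC ler_norml => /andP[_]; lra.
have pux : `|u x - p k x| <= e / 3.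
  by rewrite (le_trans (pu k x))// (le_trans _ Bk)// ler_wpM2r// lerDl.
have pxy : `|p k x - p k y| <= e / 3.
  by near: y; have /cvgrPdist_le := cp k x; exact.
rewrite distrC in puy; rewrite (le_trans (dist_le3 pux pxy puy))//.
by rewrite [leLHS](_ : _ = e)//; field.
Unshelve. all: by end_near. Qed.

Variables (n : nat) (g : R -> R -> R) (L : R).
Hypothesis L0 : 0 < L.
Hypothesis g_continuous : forall u : R -> R,
  continuous u -> continuous (fun t => g t (u t)).
Hypothesis g_lipschitz : forall t y z, `|g t y - g t z| <= L * `|y - z|.
Hypothesis g_0 : forall t, g t 0 = 0.

Fixpoint picard (d : R) (k : nat) : R -> R :=
  if k is k'.+1 then radial_solve n d (fun t => g t (picard d k' t))
  else cst d.

Let picard_sys d k : radial_system n (fun t => g t (picard d k t))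
  (picard d k.+1) (radial_average n (fun t => g t (picard d k t))).
Proof.
apply: radial_solveP; apply: g_continuous.
elim: k => [|k IH]; first by move=> x; exact: cvg_cst.
by have [] := @radial_solveP R n d _ (g_continuous IH).
Qed.

Lemma continuous_picard d k : continuous (picard d k).
Proof.
case: k => [|k]; first by move=> x; exact: cvg_cst.
by have [] := picard_sys d k.
Qed.

Lemma picard_le0 d k r : r <= 0 -> picard d k r = d.
Proof. by case: k => [//|k] r0; rewrite /= radial_solve_le0. Qed.

Let dist_g t y z K r : `|y - z| <= 2 * K * weight L r ->
  `|g t y - g t z| <= 2 * L * K * weight L r.
Proof.
move=> yz; rewrite (le_trans (g_lipschitz _ _ _))//.
rewrite [leRHS](_ : _ = L * (2 * K * weight L r)); last by ring.
by rewrite ler_pM2l.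
Qed.

Let W1 r : 1 <= weight L r. Proof. by apply: weight_ge1; exact: ltW. Qed.

(** The bound reproduces itself: the sources differ by at most 2 L |d - e| w, so the next iterates
    differ by |d - e| + |d - e| w, and w >= 1. *)
Lemma dist_picard d e k (r : R) : 0 <= r ->
  `|picard d k r - picard e k r| <= 2 * `|d - e| * weight L r.
Proof.
elim: k r => [|k IH] r r0.
  by rewrite /= (le_trans (ler_peMr _ (W1 r)))// mulr_natl mulr2n mulrDl lerDl
    mulr_ge0// ltW// weight_gt0.
have [|||] := @radial_dist_le R n _ _ _ _ _ _ L `|d - e| r L0 _
  (picard_sys d k) (picard_sys e k) _ r => //.
- by move=> s /andP[s0 sr]; apply: dist_g; exact: IH.
- by rewrite r0 lexx.
rewrite !(@picard_le0 _ _ 0 (lexx _)) => + _ => /le_trans; apply.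
have := W1 r; have := normr_ge0 (d - e).
move=> D0 Wr; have := ler_wpM2l D0 Wr; lra.
Qed.

(** All iterates start from [d], so no constant term appears and each step halves the weighted
    distance. The first step uses [g_0], which gives |g(s, d)| <= L |d|. *)
Lemma dist_picardS d k (r : R) :
  `|picard d k.+1 r - picard d k r| <= `|d| * weight L r * 2^-1 ^+ k.+1.
Proof.
have B0 s j : 0 <= `|d| * weight L s * 2^-1 ^+ j.
  by rewrite !mulr_ge0 ?exprn_ge0// ltW// weight_gt0.
have [r0|r0] := leP r 0; first by rewrite !picard_le0// subrr normr0.
elim: k r r0 => [|k IH] r r0.
  have [|||+ _] := @radial_dist_le R n _ _ _ _ _ _ L (`|d| / 2) r L0 _
    (picard_sys d 0) (radial_system_cst n d) _ r => //.
  - move=> s /andP[s0 sr]; rewrite -(g_0 s); apply: dist_g.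
    by rewrite subr0 [2 * _]mulrC divfK// ler_peMr.
  - by rewrite (ltW r0) lexx.
  rewrite (@picard_le0 _ _ 0 (lexx _)) subrr normr0 add0r expr1.
  by rewrite mulrAC.
have [|||+ _] := @radial_dist_le R n _ _ _ _ _ _ L (`|d| * 2^-1 ^+ k.+2) r L0 _
  (picard_sys d k.+1) (picard_sys d k) _ r => //.
- move=> s /andP[s0 sr]; apply: dist_g.
  have [->|sn0] := eqVneq s 0.
    by rewrite !(@picard_le0 _ _ 0 (lexx _)) subrr normr0; have := B0 0 k.+2; lra.
  have := IH s; rewrite lt_def sn0 s0 => /(_ isT) /le_trans; apply.
  by rewrite [_ ^+ k.+2]exprS [leRHS](_ : _ = `|d| * weight L s * 2^-1 ^+ k.+1)//; field.
- by rewrite (ltW r0) lexx.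
rewrite [X in _ <= X + _ -> _](_ : _ = 0); first by rewrite add0r mulrAC.
by rewrite (picard_le0 _ k.+2 (lexx 0)) (picard_le0 _ k.+1 (lexx 0)) subrr normr0.
Qed.

Let lower d r k := picard d k r - `|d| * weight L r * 2^-1 ^+ k.
Let upper d r k := picard d k r + `|d| * weight L r * 2^-1 ^+ k.

(* The intervals [lower, upper] are nested with widths tending to 0, so that
   the supremum is the limit of the iterates. *)
Definition picard_lim d r := sup (range (lower d r)).

(** The intervals are nested because one step moves the iterate by at most c 2^-(k+1), exactly the
    loss in half-width. *)
Lemma dist_picard_lim d k (r : R) :
  `|picard_lim d r - picard d k r| <= `|d| * weight L r * 2^-1 ^+ k.
Proof.
set c := `|d| * weight L r.
have c0 : 0 <= c by rewrite mulr_ge0// ltW// weight_gt0.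
have cS j : c * 2^-1 ^+ j = c * 2^-1 ^+ j.+1 + c * 2^-1 ^+ j.+1.
  by rewrite exprS; field.
have dS j := dist_picardS d j r.
have lS : {homo lower d r : i j / (i <= j)%N >-> i <= j}.
  apply: homo_leq => [//|y x z|j]; first exact: le_trans.
  have := dS j; rewrite /lower -/c ler_norml (cS j) => /andP[? ?]; lra.
have uS : {homo upper d r : i j / (i <= j)%N >-> j <= i}.
  apply: homo_leq => [//|y x z xy yz|j]; first exact: le_trans yz xy.
  have := dS j; rewrite /upper -/c ler_norml (cS j) => /andP[? ?]; lra.
have lu i j : lower d r i <= upper d r j.
  apply: (@le_trans _ _ (lower d r (maxn i j))).
    by apply: lS; exact: leq_maxl.
  apply: (@le_trans _ _ (upper d r (maxn i j))); last first.
    by apply: uS; exact: leq_maxr.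
  have := mulr_ge0 c0 (exprn_ge0 (maxn i j) (_ : 0 <= (2^-1 : R))).
  by rewrite /lower /upper -/c invr_ge0 => /(_ (ler0n _ 2)); lra.
have l_ub : has_ubound (range (lower d r)).
  by exists (upper d r 0%N) => _ [i _ <-].
have h1 : lower d r k <= picard_lim d r.
  by apply: ub_le_sup => //; exists k.
have h2 : picard_lim d r <= upper d r k.
  apply: ge_sup; first by exists (lower d r 0%N); exists 0%N.
  by move=> _ [i _ <-].
by move: h1 h2; rewrite /lower /upper -/c ler_norml => ? ?; apply/andP; split; lra.
Qed.

Lemma picard_lim_le0 d r : r <= 0 -> picard_lim d r = d.
Proof.
move=> r0; apply/eqP; rewrite -subr_eq0 -normr_le0.
apply: (@le_of_le_add_geometric _ _ (`|d| * weight L r)) => k.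
by have := dist_picard_lim d k r; rewrite add0r (picard_le0 _ _ r0).
Qed.

Lemma continuous_picard_lim d : continuous (picard_lim d).
Proof.
apply: (@continuous_geometric_limit (picard d) _ (fun r => `|d| * weight L r)).
- exact: continuous_picard.
- by move=> x; apply: cvgM; [exact: cvg_cst|exact: continuous_weight].
- by move=> k r; exact: dist_picard_lim.
Qed.

Let V d := radial_average n (fun t => g t (picard_lim d t)).

(** The limit is a fixed point of the solution operator: both it and its image lie within |d| w
    2^-(k+1) of the iterate of rank k+1, for every k. *)
Lemma picard_lim_system d :
  radial_system n (fun t => g t (picard_lim d t)) (picard_lim d) (V d).
Proof.
have S := @radial_solveP R n d _ (g_continuous (@continuous_picard_lim d)).
suff E : radial_solve n d (fun t => g t (picard_lim d t)) = picard_lim d.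
  by move: S; rewrite E.
apply/funext => r; have [r0|r0] := leP r 0.
  by rewrite radial_solve_le0// picard_lim_le0.
apply/eqP; rewrite -subr_eq0 -normr_le0.
apply: (@le_of_le_add_geometric _ _ (`|d| * weight L r)) => k; rewrite add0r.
have [|||+ _] := @radial_dist_le R n _ _ _ _ _ _ L (`|d| * 2^-1 ^+ k.+1) r L0 _
  S (picard_sys d k) _ r => //.
- move=> s _; apply: dist_g; rewrite (le_trans (dist_picard_lim d k s))//.
  by rewrite exprS [leRHS](_ : _ = `|d| * weight L s * 2^-1 ^+ k)//; field.
- by rewrite (ltW r0) lexx.
rewrite [X in _ <= X + _ -> _](_ : _ = 0); last first.
  rewrite (picard_le0 d k.+1 (lexx 0)) (@radial_solve_le0 R n d _ 0 (lexx _)).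
  by rewrite subrr normr0.
rewrite add0r.
move=> h1; have := dist_picard_lim d k.+1 r; rewrite distrC => h2.
rewrite (le_trans (ler_distD (picard d k.+1 r) _ _))//.
rewrite (le_trans (lerD h1 h2))// exprS.
by rewrite [leLHS](_ : _ = `|d| * weight L r * 2^-1 ^+ k)//; field.
Qed.

Lemma radial_flow : exists U V : R -> R -> R,
  [/\ forall d, U d 0 = d,
      forall d, radial_system n (fun t => g t (U d t)) (U d) (V d) &
      forall d e r : R, 0 <= r -> `|U d r - U e r| <= 2 * `|d - e| * weight L r /\
        `|V d r - V e r| <= 2 * L * `|d - e| * weight L r].
Proof.
exists picard_lim, V; split => [d|d|d e r r0].
- by rewrite picard_lim_le0.
- exact: picard_lim_system.
have dU s : 0 <= s -> `|picard_lim d s - picard_lim e s| <= 2 * `|d - e| * weight L s.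
  move=> s0.
  apply: (@le_of_le_add_geometric _ _ (`|d| * weight L s + `|e| * weight L s)) => k.
  have := dist_picard_lim e k s; rewrite distrC => h3.
  rewrite (le_trans (dist_le3 (dist_picard_lim d k s) (dist_picard d e k s0) h3))//.
  by rewrite [leLHS](_ : _ = 2 * `|d - e| * weight L s +
    (`|d| * weight L s + `|e| * weight L s) * 2^-1 ^+ k)//; ring.
split; first exact: dU.
have [|||_ +] := @radial_dist_le R n _ _ _ _ _ _ L `|d - e| r L0 _
  (picard_lim_system d) (picard_lim_system e) _ r => //.
- by move=> s /andP[s0 sr]; apply: dist_g; exact: dU.
- by rewrite r0 lexx.
Qed.

End picard.

(** * Shooting *)

Section shooting.
Context {R : realType}.

Lemma is_derive_locally_constant (f : R -> R) (a b c r df : R) : a < r < b ->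
  (forall s, a < s < b -> f s = c) -> is_derive r 1 f df -> df = 0.
Proof.
move=> /andP[ar rb] fc dfr.
suff d0 : is_derive r 1 f 0 by rewrite -(@derive_val _ _ _ _ _ _ _ dfr) derive_val.
apply: near_is_derive (is_derive_cst c r 1); near=> s.
by apply/esym/fc/andP; split; near: s; [exact: lt_nbhsr|exact: lt_nbhsl].
Unshelve. all: by end_near. Qed.

Variables (n : nat) (A F : R -> R).
Hypothesis A_nd : {homo A : s t / s <= t}.
Hypothesis A_gt0 : forall t, 0 < A t.
Hypothesis F_nd : {homo F : s t / s <= t}.
Hypothesis F_le0 : forall s, s <= 0 -> F s = 0.
Hypothesis A_nonconst : exists2 r : R, 0 <= r < 1 & A r != A 0.

Let F_ge0 s : 0 <= F s.
Proof.
have [s0|s0] := leP s 0; first by rewrite F_le0.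
by rewrite -(F_le0 (lexx 0)); apply/F_nd/ltW.
Qed.

Definition source (U : R -> R) (t : R) := U t - A t * F (U t).

Let radial_nd U V : radial_system n (source U) U V ->
  (forall r : R, 0 <= r <= 1 -> 0 <= V r) ->
  forall s t : R, 0 <= s -> s <= t -> t <= 1 -> U s <= U t.
Proof.
move=> [cU cV V0 dU dV] Vge0 s t s0 st t1.
have := @derivative_le R (cst 0) U (cst 0) (fun r => r * V r) s t st.
rewrite /= subrr subr_ge0; apply => //.
- by move=> x; exact: cvg_cst.
- by move=> x /andP[sx _]; apply: dU; exact: le_lt_trans sx.
- move=> x /andP[sx xt]; rewrite mulr_ge0//.
    exact: le_trans (ltW sx).
  by rewrite Vge0// (le_trans s0 (ltW sx)) (le_trans (ltW xt)).
Qed.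

Let radial_locally_constant U V (b c : R) : radial_system n (source U) U V ->
  (forall r : R, 0 < r < b -> U r = c) ->
  forall r : R, 0 < r < b -> V r = 0 /\ source U r = 0.
Proof.
move=> [cU cV V0 dU dV] Uc.
have Vr0 (r : R) : 0 < r < b -> V r = 0.
  move=> /[dup] rb /andP[r0 _].
  have /eqP := is_derive_locally_constant rb Uc (dU r r0).
  by rewrite mulf_eq0 gt_eqF//= => /eqP.
move=> r rb; split; first exact: Vr0.
case/andP: (rb) => r0 _.
have /eqP : r ^+ n * source U r = 0.
  apply: (is_derive_locally_constant rb _ (dV r r0) (c := 0)) => s sb.
  by rewrite Vr0// mulr0.
by rewrite mulf_eq0 expf_eq0 gt_eqF//= andbF => /eqP.
Qed.

(* If the conclusion fails, [z := U - U 0] is a nonnegative subsolution of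
   [z'' + n/r z' = z] with [z 0 = 0], because [A] and [F] are nondecreasing. *)
Lemma radial_initial_lt U V : radial_system n (source U) U V -> 0 < U 0 ->
  (forall r : R, 0 <= r <= 1 -> 0 <= V r) -> A 0 * F (U 0) < U 0.
Proof.
move=> S d0 Vge0; rewrite ltNge; apply/negP => dle.
have Und := radial_nd S Vge0.
have U1 (r : R) : 0 <= r <= 1 -> U r = U 0.
  move=> /[dup] r01 /andP[r0 r1]; apply/eqP; rewrite eq_le [U 0 <= _]Und// andbT.
  have := @radial_gronwall R n _ _ _ 1 1 ltr01
    (radial_systemB S (radial_system_cst n (U 0))) _ r r01.
  rewrite /= subrr maxxx mulr0 mul0r subr_le0; apply => s /andP[s0 s1].
  rewrite subr0 mul1r le_max; apply/orP; right.
  rewrite /source lerB// (le_trans dle)//.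
  apply: ler_pM => //; [exact: ltW|exact: A_nd|by apply/F_nd/Und].
have [r /andP[r0 r1] /eqP] := A_nonconst; apply.
have [->//|rn0] := eqVneq r 0.
have r01 : 0 < r < 1 by rewrite lt_def rn0 r0.
have U1' (s : R) : 0 < s < 1 -> U s = U 0.
  by move=> /andP[s0 s1]; apply: U1; rewrite !ltW.
(* With [U] constant the source vanishes on (0, 1), so [A r * F (U 0) = U 0]. Monotonicity of [A]
   and [dle] give the same value at 0, and the factor [F (U 0)] is nonzero as [U 0 > 0]. *)
have [_] := radial_locally_constant S U1' r01.
rewrite /source (U1' _ r01) => /eqP; rewrite subr_eq0 => /eqP dE.
have AF : A 0 * F (U 0) = A r * F (U 0).
  apply/eqP; rewrite eq_le -[X in _ && (X <= _)]dE dle andbT.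
  by rewrite ler_wpM2r// A_nd.
apply/esym; apply: (mulIf _ AF); apply/eqP => F0.
by move: dE d0; rewrite F0 mulr0 => ->; rewrite ltxx.
Qed.

(* At a zero [r0 < 1] of [V], [s^(n+1) V] has a minimum, so the source vanishes.
   Backwards from [r0], [v := U r0 - U] then satisfies [s^(n+1) V <= v], which
   is a linear differential inequality for [v] with [v r0 = 0]. *)
Lemma radial_touch U V (r0 : R) : radial_system n (source U) U V -> 0 < U 0 ->
  (forall r : R, 0 <= r <= 1 -> 0 <= V r) -> 0 <= r0 < 1 -> 0 < V r0.
Proof.
move=> S d0 Vge0 /andP[]; rewrite le_eqVlt => /predU1P[<- _|r00 r01].
  have [_ _ -> _ _] := S; rewrite divr_gt0// subr_gt0.
  exact: radial_initial_lt S d0 Vge0.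
rewrite lt_def Vge0 ?(ltW r00) ?(ltW r01)// andbT; apply/eqP => Vr0.
have Und := radial_nd S Vge0.
have [cU cV V0 dU dV] := S.
pose w (s : R) := s ^+ n.+1 * V s.
have cw : continuous w.
  by move=> x; apply: cvgM; [exact: exprn_continuous|exact: cV].
have w0 (s : R) : 0 <= s <= 1 -> 0 <= w s.
  by move=> /[dup] s01 /andP[s0 _]; rewrite mulr_ge0 ?exprn_ge0 ?Vge0.
have wr0 : w r0 = 0 by rewrite /w Vr0 mulr0.
have hr0 : source U r0 = 0.
  have r01' : r0 \in `]0, 1[ by rewrite in_itv/= r00.
  have [|s|] := @derive1_at_min R w 0 1 r0 ler01 _ r01' _.
  - move=> s; rewrite in_itv/= => /andP[s0 _].
    exact: (@ex_derive _ _ _ _ _ _ _ (dV s s0)).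
  - by rewrite in_itv/= => /andP[s0 s1]; rewrite wr0 w0// !ltW.
  move=> _; rewrite (@derive_val _ _ _ _ _ _ _ (dV r0 r00)) => /eqP.
  by rewrite mulf_eq0 expf_eq0 gt_eqF//= andbF => /eqP.
have Uconst (rho : R) : 0 < rho < r0 -> U rho = U r0.
  move=> /andP[rho0 rhor0]; apply/eqP.
  rewrite eq_le (Und _ _ (ltW rho0) (ltW rhor0) (ltW r01))/=.
  have wv (s : R) : rho < s < r0 -> w s <= U r0 - U s.
    move=> /andP[rhos sr0]; have s0 := lt_trans rho0 rhos.
    have v0 : 0 <= U r0 - U s by rewrite subr_ge0 Und// ltW.
    (* The lower bound U(s) - U(r0) on w' is integrated over [s, r0], of length at most 1, with
       w(r0) = 0. *)
    have := @derivative_le R (fun t => (U s - U r0) * t) w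
      (fun=> U s - U r0) (fun t => t ^+ n * source U t) s r0 (ltW sr0).
    rewrite wr0 sub0r -mulrBr => H.
    have : (U s - U r0) * (r0 - s) <= - w s.
      apply: H => //.
      + by move=> x; apply: cvgM; [exact: cvg_cst|exact: cvg_id].
      + by move=> x _; exact: is_derive_mull.
      + by move=> x /andP[sx _]; apply: dV; exact: lt_trans sx.
      + move=> x /andP[sx xr0]; have x0 := lt_trans s0 sx.
        have x1 := lt_trans xr0 r01.
        (* By monotonicity A(x) F(U(x)) <= A(r0) F(U(r0)), and the right side is U(r0) because the
           source vanishes at r0. *)
        have hx : U s - U r0 <= source U x.
          move: hr0 => /eqP; rewrite subr_eq0 => /eqP ->.
          rewrite /source lerB//; first by rewrite Und// ltW.
          apply: ler_pM => //; first exact: ltW.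
            exact/A_nd/ltW.
          by apply/F_nd/Und; exact: ltW.
        have xn0 : 0 <= x ^+ n by rewrite exprn_ge0// ltW.
        have xn1 : x ^+ n <= 1 by rewrite exprn_ile1// ltW.
        apply: le_trans (ler_wpM2l xn0 hx).
        by rewrite -[leLHS]mul1r ler_wnM2r// subr_le0 Und// ltW.
    rewrite -[leLHS]opprK -mulNr opprB lerN2 => /le_trans; apply.
    by rewrite ler_piMr// lerBlDr (le_trans (ltW r01))// lerDl ltW.
  (* With v = U(r0) - U, one has -v' = x V = w / x^n <= k v on (rho, r0), so v exp(k t) is
     nondecreasing and ends at 0. The constant blows up at the origin, which is why [rho > 0] is
     fixed. *)
  pose k := (rho ^+ n)^-1.
  have rn0 : 0 < rho ^+ n by rewrite exprn_gt0.
  have k0 : 0 < k by rewrite invr_gt0.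
  pose E (t : R) := expR (k * t).
  have dE (x : R) : is_derive x 1 E (k * E x).
    have := @is_derive1_comp R expR (fun t : R => k * t) x _ _
      (is_derive_expR _) (is_derive_mull k x).
    by move/is_derive_eq; apply; rewrite mulrC.
  have cE := is_derive_continuous dE.
  pose phi := (fun t : R => (U r0 - U t) * E t).
  have := @derivative_le R (cst 0) phi (cst 0)
    (fun t => (U r0 - U t) * (k * E t) + E t * - (t * V t)) rho r0 (ltW rhor0).
  rewrite /= subrr /phi subrr mul0r sub0r oppr_ge0 => H.
  have {H} : (U r0 - U rho) * E rho <= 0.
    apply: H.
    - by move=> x; exact: cvg_cst.
    - move=> x; apply: cvgM; last exact: cE.
      by apply: cvgB; [exact: cvg_cst|exact: cU].
    - move=> x /andP[rhox _]; have x0 := lt_trans rho0 rhox.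
      have dv : is_derive x 1 (fun t : R => U r0 - U t) (- (x * V x)).
        have := @is_deriveB _ _ _ (cst (U r0)) U x 1 0 _ (is_derive_cst _ _ _) (dU x x0).
        by rewrite sub0r.
      exact: is_deriveM dv (dE x).
    - move=> x /andP[rhox xr0]; have x0 := lt_trans rho0 rhox.
      have := wv x; rewrite rhox xr0 => /(_ isT) wx.
      have rx : rho ^+ n <= x ^+ n by rewrite lerXn2r ?nnegrE ?ltW.
      have v0 : 0 <= x * V x.
        apply: mulr_ge0; first exact: ltW.
        by apply: Vge0; rewrite (ltW x0) (ltW (lt_trans xr0 r01)).
      have : x * V x <= k * (U r0 - U x).
        rewrite /k [leRHS]mulrC ler_pdivlMr// (le_trans _ wx)// /w exprSr -mulrA.
        by rewrite mulrC ler_wpM2r.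
      rewrite -subr_ge0 => H.
      have -> : (U r0 - U x) * (k * E x) + E x * - (x * V x) =
        (k * (U r0 - U x) - x * V x) * E x by ring.
      by rewrite mulr_ge0// ltW// expR_gt0.
  by rewrite pmulr_lle0 ?expR_gt0// subr_le0.
(* [U] is constant on (0, r0), so [V] vanishes there and, by continuity, at 0. Then
   [U 0 = A 0 * F (U 0)], which [radial_initial_lt] excludes; the forward Gronwall argument is
   contained in that lemma. *)
have V00 : V 0 = 0.
  have VV : V r @[r --> 0^'+] --> V 0.
    by apply: cvg_at_right_filter; exact: cV.
  have V00' : V r @[r --> 0^'+] --> (0:R).
    apply: (@cvg_trans _ ((fun=> 0 : R) @ 0^'+)); last exact: cvg_cst.
    apply: near_eq_cvg; near=> r.
    have [|-> //] := radial_locally_constant S Uconst (r := r).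
    by apply/andP; split => //; near: r; exact: nbhs_right_lt.
  exact: (cvg_unique _ VV V00').
have := radial_initial_lt S d0 Vge0; move: V00; rewrite V0 => /eqP.
rewrite mulf_eq0 invr_eq0 pnatr_eq0 orbF subr_eq0 => /eqP <-.
by rewrite ltxx.
Unshelve. all: by end_near. Qed.

(** * A priori bounds and the choice of the shooting parameter *)

Variables (M LF : R).
Hypothesis A_continuous : continuous A.
Hypothesis A_le1 : forall t, A t <= A 1.
Hypothesis LF_ge0 : 0 <= LF.
Hypothesis F_lipschitz : forall y z, `|F y - F z| <= LF * `|y - z|.
Hypothesis F_small : exists2 s0 : R, 0 < s0 &
  forall s : R, 0 < s <= s0 -> A 1 * F s < s.
Hypothesis M_gt0 : 0 < M.
Hypothesis F_large : M < A 0 * F M.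

Let F_continuous : continuous F.
Proof.
move=> x; apply/cvgrPdist_le => e e0.
have L10 : 0 < LF + 1 by rewrite ltr_wpDl.
near=> y; rewrite (le_trans (F_lipschitz _ _))//.
rewrite (@le_trans _ _ ((LF + 1) * `|x - y|))// ?ler_wpM2r ?lerDl//.
rewrite mulrC -ler_pdivlMr//; near: y.
by have /cvgrPdist_le := @cvg_id _ (nbhs x); apply; rewrite divr_gt0.
Unshelve. all: by end_near. Qed.

(** As A F >= 0, the source is at most [U], and Gronwall applies with L = 1. The bound does not
    involve [A] or [F], so it is the same for every truncation. *)
Lemma radial_upper U V : radial_system n (source U) U V -> 0 < U 0 ->
  forall r : R, 0 <= r <= 1 -> U r <= 2 * U 0 * weight 1 r.
Proof.
move=> S d0 r r01; have := @radial_gronwall R n _ _ _ 1 1 ltr01 S _ r r01.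
rewrite (max_idPr (ltW d0)); apply => s _.
rewrite mul1r le_max; apply/orP; right.
by rewrite /source gerBl mulr_ge0// ltW.
Qed.

(** Gronwall for [U 0 - U], which starts at 0. Where 0 < U <= s0 its source is negative; where U <=
    0, [F] vanishes and the source is -U <= U(0) - U. *)
Lemma radial_lower U V (s0 : R) : radial_system n (source U) U V -> 0 < U 0 ->
  (forall r : R, 0 <= r <= 1 -> U r <= s0) ->
  (forall s : R, 0 < s <= s0 -> A 1 * F s < s) ->
  forall r : R, 0 <= r <= 1 -> U 0 <= U r.
Proof.
move=> S d0 Ule sF r r01.
have := @radial_gronwall R n _ _ _ 1 1 ltr01
  (radial_systemB (radial_system_cst n (U 0)) S) _ r r01.
rewrite /= subrr maxxx mulr0 mul0r subr_le0; apply => s s01.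
rewrite sub0r mul1r le_max /source opprB.
have [Us0|Us0] := leP (U s) 0.
  by rewrite F_le0// mulr0 (lerB (ltW d0))// orbT.
rewrite subr_le0 (le_trans (ler_wpM2r (F_ge0 _) (A_le1 _)))//.
by rewrite ltW// sF// Us0 Ule.
Qed.

Lemma radial_increasing_of_source U V : radial_system n (source U) U V ->
  (forall r : R, 0 <= r <= 1 -> 0 < source U r) ->
  forall r : R, 0 <= r <= 1 -> 0 < V r.
Proof.
move=> [cU cV V0 dU dV] h0 r /andP[]; rewrite le_eqVlt => /predU1P[<- _|r0 r1].
  by rewrite V0 divr_gt0// h0// lexx ler01.
have [s||c] := @MVT R (fun s => s ^+ n.+1 * V s) (fun s => s ^+ n * source U s) 0 r r0.
- by rewrite in_itv/= => /andP[s0 _]; exact: dV.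
- apply: continuous_subspaceT => x.
  by apply: cvgM; [exact: exprn_continuous|exact: cV].
rewrite in_itv/= => /andP[c0 cr]; rewrite expr0n/= mul0r !subr0 => E.
have : 0 < r ^+ n.+1 * V r.
  rewrite E !mulr_gt0 ?exprn_gt0// h0// ltW//=.
  by rewrite (le_trans (ltW cr)).
by rewrite pmulr_rgt0// exprn_gt0.
Qed.

Lemma shooting : exists U V : R -> R,
  [/\ radial_system n (source U) U V, 0 < U 0 <= M,
      V 1 = 0,
      forall r : R, 0 <= r < 1 -> 0 < V r &
      forall r : R, 0 <= r <= 1 -> U r <= 2 * M * weight 1 1].
Proof.
pose L := 1 + A 1 * LF.
have L0 : 0 < L by rewrite ltr_pwDl// mulr_ge0// ltW.
pose g t y := y - A t * F y.
have [|t y z|t|U [V [U0 S dUV]]] := @radial_flow R n g L L0.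
- move=> u cu x; apply: cvgB; first exact: cu.
  apply: cvgM; first exact: A_continuous.
  exact: (continuous_comp (cu x) (@F_continuous (u x))).
- rewrite /g.
  have -> : y - A t * F y - (z - A t * F z) = (y - z) - A t * (F y - F z) by ring.
  rewrite (le_trans (ler_normB _ _))// mulrDl mul1r lerD2l normrM.
  rewrite gtr0_norm// -mulrA ler_pM// ltW//.
- by rewrite /g F_le0// mulr0 subr0.
have W1 r : 0 <= r <= 1 -> weight 1 r <= weight 1 1.
  move=> /andP[r0 r1]; rewrite ler_expR !mul1r expr1n.
  by rewrite exprn_ile1.
have WL r : 0 <= r <= 1 -> weight L r <= weight L 1.
  move=> /andP[r0 r1]; rewrite ler_expR expr1n ler_pM2l//.
  by rewrite exprn_ile1.
pose C := 2 * L * weight L 1.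
have C0 : 0 < C by rewrite !mulr_gt0// weight_gt0.
have dV d e r : 0 <= r <= 1 -> `|V d r - V e r| <= C * `|d - e|.
  move=> /[dup] r01 /andP[r0 _]; have [_ /le_trans] := dUV d e r r0; apply.
  by rewrite /C -mulrA [`|_| * _]mulrC mulrA ler_wpM2r// ler_pM2l ?mulr_gt0// WL.
pose D := [set d | 0 < d <= M /\ forall r : R, 0 <= r <= 1 -> 0 < V d r].
have Dub : has_ubound D by exists M => d [/andP[]].
have [s0 s00 sF] := F_small.
have D0 : D !=set0.
  (* By [radial_upper] this choice keeps [U d] below [s0] on [0, 1], and [radial_lower] keeps it
     above [d]; hence the source is positive. *)
  pose d := Num.min M (s0 / (2 * weight 1 1)).
  have w20 : 0 < 2 * weight 1 1 :> R by rewrite mulr_gt0// weight_gt0.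
  have d0 : 0 < d by rewrite lt_min M_gt0 divr_gt0.
  have Ud0 : 0 < U d 0 by rewrite U0.
  have Us r : 0 <= r <= 1 -> U d r <= s0.
    move=> r01; rewrite (le_trans (radial_upper (S d) Ud0 r01))// U0.
    rewrite (@le_trans _ _ (2 * d * weight 1 1))//.
      by rewrite ler_wpM2l ?mulr_ge0 ?(ltW d0)// W1.
    by rewrite mulrAC mulrC -ler_pdivlMr// ge_min lexx orbT.
  exists d; split; first by rewrite d0 ge_min lexx.
  apply: (radial_increasing_of_source (S d)) => r r01.
  have Ur := radial_lower (S d) Ud0 Us sF r01.
  rewrite subr_gt0 (le_lt_trans (ler_wpM2r (F_ge0 _) (A_le1 _)))//.
  by rewrite sF// Us// andbT (lt_le_trans _ Ur).
pose d := sup D.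
have dsup : has_sup D by split.
have d0 : 0 < d.
  have [e De] := D0; have [/andP[e0 _] _] := De.
  by rewrite (lt_le_trans e0)//; exact: ub_le_sup.
have dM : d <= M by apply: ge_sup => // e [/andP[]].
have Ud0 : 0 < U d 0 by rewrite U0.
have Vd_ge0 r : 0 <= r <= 1 -> 0 <= V d r.
  move=> r01; rewrite leNgt; apply/negP => Vlt0.
  (* A parameter of [D] closer to [d] than this would still have a nonpositive [V] at [r], by the
     Lipschitz dependence [dV]. *)
  have e0 : 0 < - V d r / C by rewrite divr_gt0// oppr_gt0.
  have [e De de] := sup_adherent e0 dsup.
  have [_ /(_ r r01) Ve] := De.
  have ed : e <= d by exact: ub_le_sup.
  have := dV d e r r01; rewrite (ger0_norm (_ : 0 <= d - e)) ?subr_ge0//.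
  have : C * (d - e) <= - V d r.
    by rewrite mulrC -ler_pdivlMr// lerBlDr -lerBlDl ltW.
  rewrite ler_norml => H /andP[+ _]; rewrite -/d in de; lra.
(* This excludes [d = M], in view of [F_large], so that [D] can be left to the right of [d] without
   exceeding [M]. *)
have d_lt : A 0 * F d < d.
  by have := radial_initial_lt (S d) Ud0 Vd_ge0; rewrite U0.
have dltM : d < M.
  rewrite lt_neqAle dM andbT; apply/eqP => dE.
  by move: F_large d_lt; rewrite dE => /lt_trans /[apply]; rewrite ltxx.
have [r0 [r001 Vr0]] : exists r0 : R, 0 <= r0 <= 1 /\ V d r0 = 0.
  apply: contrapT => H.
  have Vd_gt0 r : 0 <= r <= 1 -> 0 < V d r.
    move=> r01; rewrite lt_neqAle Vd_ge0// andbT; apply/eqP => Vr.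
    by apply: H; exists r.
  have [_ cVd _ _ _] := S d.
  have [c] := EVT_min ler01 (continuous_subspaceT cVd).
  rewrite in_itv/= => c01 cmin.
  have m0 := Vd_gt0 c c01.
  (* For this parameter [V] changes by at most half of its minimum [V d c], so it stays positive on
     [0, 1]. *)
  pose e := Num.min M (d + V d c / (2 * C)).
  have C20 : 0 < 2 * C by rewrite mulr_gt0.
  have de : d < e by rewrite lt_min dltM ltrDl divr_gt0.
  have : D e.
    split; first by rewrite (lt_trans d0 de) ge_min lexx.
    move=> r r01; have Vc := cmin r; rewrite in_itv/= r01 in Vc.
    have {}Vc := Vc isT.
    have := dV d e r r01; rewrite (ltr0_norm (_ : d - e < 0)) ?subr_lt0// opprB.
    have : e - d <= V d c / (2 * C) by rewrite lerBlDl ge_min lexx orbT.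
    rewrite ler_pdivlMr// => ed; rewrite ler_norml => /andP[_ H1].
    have {}ed : C * (e - d) <= V d c / 2 by lra.
    lra.
  by move=> De; have := ub_le_sup Dub De; rewrite leNgt de.
have r0E : r0 = 1.
  have [r00 r01] := andP r001.
  apply/eqP; rewrite eq_le r01/= leNgt; apply/negP => r0lt.
  have := radial_touch (S d) Ud0 Vd_ge0 (r0 := r0).
  by rewrite r00 r0lt Vr0 ltxx => /(_ isT).
exists (U d), (V d); split.
- exact: S.
- by rewrite U0 d0 ltW.
- by rewrite -r0E.
- by move=> r r01; exact: (radial_touch (S d) Ud0 Vd_ge0 r01).
- move=> r r01; rewrite (le_trans (radial_upper (S d) Ud0 r01))// U0.
  rewrite ler_pM ?W1// ?ler_pM2l// ?mulr_ge0// ?ltW// ?weight_gt0//.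
Qed.

End shooting.

(** * Integration on R^n *)

Section rV.
Context {R : realType}.

Lemma continuous_rV (T : topologicalType) n (f : T -> 'rV[R]_n) :
  (forall i, continuous (fun t => f t ord0 i)) -> continuous f.
Proof.
move=> cf x; apply/cvg_ballP => e e0.
have : \forall t \near x, forall i, ball (f x ord0 i) e (f t ord0 i).
  by apply: filter_forall => i; have /cvg_ballP := cf i x; exact.
by apply: filterS => t ft; split => // i j; rewrite (ord1 i).
Qed.

Lemma continuous_coor n (i : 'I_n) : continuous (fun x : 'rV[R]_n => x ord0 i).
Proof. exact: coord_continuous. Qed.

Lemma measurable_forall_rV n (P : 'I_n -> set R) :
  (forall i, measurable (P i)) ->
  measurable [set x : 'rV[R]_n | forall i, P i (x ord0 i)].
Proof.
move=> mP.
rewrite (_ : mkset _ = \bigcap_(i in setT) ((fun x : 'rV[R]_n => x ord0 i) @^-1` P i)).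
  apply: fin_bigcap_measurable; first exact: finite_finset.
  move=> i _; rewrite -[X in measurable X]setTI.
  exact: measurable_coor.
by apply/seteqP; split => x /= h i; [move=> _; exact: h|exact: h].
Qed.

(* A continuous function is the pointwise limit of its samples on the lattice
   [Z^n / (k+1)]. *)
Lemma measurable_continuous_rV n (phi : 'rV[R]_n -> R) :
  continuous phi -> measurable_fun setT phi.
Proof.
move=> cphi.
pose fl k (x : 'rV[R]_n) : 'rV[int]_n := \row_i Num.floor (k.+1%:R * x ord0 i).
pose q k (z : 'rV[int]_n) : 'rV[R]_n := \row_i ((z ord0 i)%:~R / k.+1%:R).
apply: (@measurable_fun_cvg _ _ _ _ (fun k => phi \o q k \o fl k)).
- move=> k _ Y mY; rewrite setTI.
  rewrite (_ : _ @^-1` _ =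
    \bigcup_z (if `[< Y (phi (q k z)) >] then fl k @^-1` [set z] else set0)); last first.
    apply/seteqP; split => [x Yx|x [z _]].
      by exists (fl k x) => //; rewrite asboolT.
    by case: asboolP => // Yz /= ->.
  apply: countable_bigcupT_measurable; first exact: countableP.
  move=> z; case: asboolP => // _.
  rewrite (_ : _ @^-1` _ = [set x : 'rV[R]_n | forall i,
      `[(z ord0 i)%:~R / k.+1%:R, (z ord0 i + 1)%:~R / k.+1%:R[%classic (x ord0 i)]).
    apply: (@measurable_forall_rV n (fun i =>
      `[(z ord0 i)%:~R / k.+1%:R, (z ord0 i + 1)%:~R / k.+1%:R[%classic)) => i.
    exact: measurable_itv.
  have flE (x : 'rV[R]_n) i : (Num.floor (k.+1%:R * x ord0 i) == z ord0 i) =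
      (x ord0 i \in `[(z ord0 i)%:~R / k.+1%:R, (z ord0 i + 1)%:~R / k.+1%:R[).
    by rewrite floor_eq in_itv/= ler_pdivrMr// ltr_pdivlMr// mulrC.
  apply/seteqP; split => x /= h.
    by move=> i; rewrite -flE -h mxE.
  by apply/rowP => i; rewrite mxE; apply/eqP; rewrite flE; exact: h.
- move=> x _; apply: continuous_cvg; first exact: cphi.
  apply/cvg_ballP => e e0.
  have : \forall k \near \oo, k.+1%:R^-1 < e.
    exact: (near_infty_natSinv_lt (PosNum e0)).
  apply: filterS => k ke; split => // i j; rewrite (ord1 i) !mxE.
  have k0 : 0 < k.+1%:R :> R by rewrite ltr0n.
  rewrite /ball/= (le_lt_trans _ ke)// ler_norml.
  have /andP[f1 f2] := floor_itv (k.+1%:R * x ord0 j).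
  set z := Num.floor _ in f1 f2 *.
  have f1' : z%:~R / k.+1%:R <= x ord0 j by rewrite ler_pdivrMr// mulrC.
  have f2' : x ord0 j <= z%:~R / k.+1%:R + k.+1%:R^-1.
    by rewrite -[X in _ + X]mul1r -mulrDl ler_pdivlMr// mulrC -intrD1 ltW.
  have v0 : 0 <= (k.+1%:R : R)^-1 by rewrite invr_ge0.
  by rewrite lerBlDl f2' andbT lerBrDl (le_trans _ f1')// gerBl.
Qed.

(** * Cubes, and the vanishing integral of a compactly supported derivative *)

Definition box n (a b : R) : set 'rV[R]_n :=
  [set x | forall i, `[a, b]%classic (x ord0 i)].

Lemma measurable_box n (a b : R) : measurable (@box n a b).
Proof.
apply: (@measurable_forall_rV n (fun=> `[a, b]%classic)) => i.
exact: measurable_itv.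
Qed.

Lemma lebesgue_box n (a b : R) : a <= b ->
  lebesgue_rV n (@box n a b) = ((b - a) ^+ n)%:E.
Proof.
move=> ab; elim: n => [|n IH].
  rewrite /= diracE mem_set// => i; by case: i.
rewrite /= /lebesgue_rV_succ /pushforward.
rewrite (_ : _ @^-1` _ = `[a, b]%classic `*` @box n a b); last first.
  apply/seteqP; split => [[t y]/= h|[t y]/= [ht hy] i].
    split.
      by have := h ord0; rewrite mxE unlift_none.
    by move=> i; have := h (lift ord0 i); rewrite mxE liftK.
  by case: (unliftP ord0 i) => [j|] ->; rewrite mxE ?liftK ?unlift_none;
    [exact: hy|exact: ht].
rewrite product_measure1E//; last exact: measurable_box.
transitivity ((b - a)%:E * ((b - a) ^+ n)%:E)%E; last by rewrite -EFinM exprS.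
congr (_ * _)%E; last exact: IH.
apply: (etrans (lebesgue_measure_itv `[a, b])); rewrite /= lte_fin.
case: ltP => [_|ba]; first by rewrite -EFinD.
have -> : b = a by apply/eqP; rewrite eq_le ab ba.
by rewrite subrr.
Qed.

Lemma compact_box n (a b : R) : compact (@box n a b).
Proof.
apply: (@rV_compact R n (fun=> `[a, b]%classic)) => i; exact: segment_compact.
Qed.

Lemma bounded_continuous_box n (a b : R) (phi : 'rV[R]_n -> R) :
  continuous phi -> exists C, forall x, box a b x -> `|phi x| <= C.
Proof.
move=> cphi; have := @compact_bounded R _ _ (continuous_compact
  (continuous_subspaceT cphi) (@compact_box n a b)).
move=> [C [_ /(_ (C + 1))]]; rewrite ltrDl ltr01 => /(_ isT) h.
by exists (C + 1) => x bx; apply: h; exists x.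
Qed.

Lemma integrable_bounded_support d (T : measurableType d)
    (mu : {measure set T -> \bar R}) (B : set T) (f : T -> R) (C : R) :
  measurable B -> (mu B < +oo)%E -> measurable_fun setT f ->
  (forall x, `|f x| <= C) -> (forall x, ~ B x -> f x = 0) ->
  mu.-integrable setT (EFin \o f).
Proof.
move=> mB Bfin mf fC f0.
have H : mu.-integrable B (EFin \o f).
  apply: measurable_bounded_integrable => //; first exact: measurable_funTS.
  exists C; split; first exact: num_real.
  by move=> y Cy x _ /=; apply: (le_trans (fC x)); exact: ltW.
have -> : EFin \o f = (EFin \o f) \_ B.
  apply/funext => x; rewrite patchE; case: ifPn => //.
  by move=> /negP; rewrite inE => /f0 /= ->.
by apply/integrable_restrict => //; rewrite setTI.
Qed.

(** The difference quotients of [h \o c] along [v1] and of [h] along [v2] are the same function of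
    s. It serves to differentiate along slices of [rV_cons]. *)
Lemma is_derive_affine (V1 V2 : normedModType R) (c : V1 -> V2) (v1 x : V1)
    (v2 : V2) (h : V2 -> R) (d : R) :
  (forall s : R, c (s *: v1 + x) = s *: v2 + c x) ->
  is_derive (c x) v2 h d -> is_derive x v1 (h \o c) d.
Proof.
move=> E [dh <-].
have HE : (fun s : R => s^-1 *: (((h \o c) \o shift x) (s *: v1) - (h \o c) x)) =
    (fun s => s^-1 *: ((h \o shift (c x)) (s *: v2) - h (c x))).
  by apply/funext => s /=; rewrite E.
by split; rewrite /derivable /derive HE.
Qed.

Lemma integral_derivative_eq0 (h k : R -> R) (A : R) : 0 < A ->
  (forall t : R, is_derive t 1 h (k t)) -> continuous k ->
  (forall t : R, A <= `|t| -> h t = 0) -> (forall t : R, A <= `|t| -> k t = 0) ->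
  (\int[@lebesgue_measure R]_t (k t)%:E = 0)%E.
Proof.
move=> A0 dh ck h0 k0.
have AA : - A < A by rewrite gtrN.
have ch := is_derive_continuous dh.
have : (\int[lebesgue_measure]_(x in `[(- A)%R, A]) (k x)%:E = (h A)%:E - (h (- A))%:E)%E.
  apply: continuous_FTC2 => //.
  - exact: continuous_subspaceT.
  - split.
    + by move=> x _; exact: (@ex_derive _ _ _ _ _ _ _ (dh x)).
    + by apply: cvg_at_right_filter; exact: ch.
    + by apply: cvg_at_left_filter; exact: ch.
  - by move=> x _; rewrite derive1E; exact: (@derive_val _ _ _ _ _ _ _ (dh x)).
have hA : h A = 0 by apply: h0; exact: ler_norm.
have hNA : h (- A) = 0 by apply: h0; rewrite normrN; exact: ler_norm.
rewrite hA hNA sube0 => E; rewrite -[RHS]E.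
rewrite [RHS]integral_mkcond; apply: eq_integral => t _.
rewrite patchE; case: ifPn => //; rewrite notin_setE/= in_itv/= => /negP H.
rewrite k0// leNgt; apply: contra H => /ltW; by rewrite ler_norml.
Qed.

Lemma continuous_rV_consl n (y : 'rV[R]_n) :
  continuous (fun t : R => rV_cons (t : measurableTypeR R, y)).
Proof.
apply: continuous_rV => i; rewrite /rV_cons.
case: (unliftP ord0 i) => [j|] ->.
  by under eq_fun do rewrite mxE liftK; move=> x; exact: cvg_cst.
by under eq_fun do rewrite mxE unlift_none; move=> x; exact: cvg_id.
Qed.

Lemma continuous_rV_consr n (t : measurableTypeR R) :
  continuous (fun y : 'rV[R]_n => rV_cons (t, y)).
Proof.
apply: continuous_rV => i; rewrite /rV_cons.
case: (unliftP ord0 i) => [j|] ->.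
  by under eq_fun do rewrite mxE liftK; exact: continuous_coor.
rewrite (_ : (fun _ => _) = cst (t : R)); first exact: cst_continuous.
by apply/funext => y; rewrite mxE unlift_none.
Qed.

(** Induction on the dimension by Fubini. If [i] is the first coordinate, the inner integral is
    taken along it and vanishes by the fundamental theorem of calculus; otherwise the first
    coordinate is frozen and the induction hypothesis applies to the slice. Support in a cube,
    unlike support in a ball, passes to slices unchanged. *)
Lemma integral_partial_eq0 n (i : 'I_n) (h k : 'rV[R]_n -> R) (A C : R) :
  0 < A -> (forall x, is_derive x (delta_mx ord0 i) h (k x)) ->
  continuous k -> (forall x, `|k x| <= C) ->
  (forall (x : 'rV[R]_n) j, A <= `|x ord0 j| -> h x = 0) ->
  (forall (x : 'rV[R]_n) j, A <= `|x ord0 j| -> k x = 0) ->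
  (\int[lebesgue_rV n]_x (k x)%:E = 0)%E.
Proof.
move=> A0; elim: n => [|n IH] in i h k *; first by case: i.
move=> dh ck kC h0 k0.
have AA : - A <= A by rewrite ge0_cp ?ltW.
have mk := measurable_continuous_rV ck.
have ik : (lebesgue_measure \x lebesgue_rV n)%E.-integrable setT
    (EFin \o (k \o @rV_cons R n)).
  apply: (@integrable_bounded_support _ _ _ (@rV_cons R n @^-1` box (- A) A) _ C).
  - rewrite -[X in measurable X]setTI; apply: measurable_rV_cons => //.
    exact: measurable_box.
  - have := @lebesgue_box n.+1 (- A) A AA.
    by rewrite /= /lebesgue_rV_succ /pushforward => ->; rewrite ltry.
  - by apply: (measurableT_comp mk); exact: (@measurable_rV_cons R n).
  - by move=> x; exact: kC.
  - move=> x /existsNP[j] /=; rewrite in_itv/= => /negP H.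
    apply: (k0 _ j); rewrite leNgt; apply: contra H => /ltW.
    by rewrite ler_norml.
have -> : (\int[lebesgue_rV n.+1]_x (k x)%:E =
    \int[(lebesgue_measure \x lebesgue_rV n)]_p (k (rV_cons p))%:E)%E.
  rewrite /= /lebesgue_rV_succ integral_pushforward//.
  exact/measurable_EFinP.
case: (unliftP ord0 i) => [j|] iE.
- rewrite -(integral12_prod_meas1 ik)/=.
  transitivity (\int[@lebesgue_measure R]_t (0 : \bar R))%E; last exact: integral0.
  apply: eq_integral => t _; rewrite /fubini_F/=.
  apply: (IH j (h \o (fun y => rV_cons (t, y))) (k \o (fun y => rV_cons (t, y)))).
  + move=> y; apply: (@is_derive_affine 'rV[R]_n 'rV[R]_n.+1
      (fun y => rV_cons (t, y)) (delta_mx ord0 j) y (delta_mx ord0 i) h _ _ (dh _)).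
    move=> s; apply/rowP => l; rewrite !mxE iE.
    by case: (unliftP ord0 l) => [m|] ->;
      rewrite ?mxE ?eqxx//= ?(inj_eq lift_inj) ?mulr0 ?add0r.
  + by move=> y; apply: continuous_comp; [exact: continuous_rV_consr|exact: ck].
  + by move=> y /=; exact: kC.
  + by move=> y l yl /=; apply: (h0 _ (lift ord0 l)); rewrite mxE liftK.
  + by move=> y l yl /=; apply: (k0 _ (lift ord0 l)); rewrite mxE liftK.
- rewrite -(integral21_prod_meas1 ik)/=.
  transitivity (\int[lebesgue_rV n]_t (0 : \bar R))%E; last exact: integral0.
  apply: eq_integral => y _; rewrite /fubini_G/=.
  apply: (@integral_derivative_eq0 (h \o (fun t => rV_cons (t, y)))
    (k \o (fun t => rV_cons (t, y))) A A0).
  + move=> t; apply: (@is_derive_affine R 'rV[R]_n.+1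
      (fun t : R => rV_cons (t : measurableTypeR R, y)) 1 t (delta_mx ord0 i)
      h _ _ (dh _)).
    move=> s; apply/rowP => l; rewrite !mxE iE.
    by case: (unliftP ord0 l) => [m|] ->; rewrite ?mxE ?eqxx//= ?mulr0 ?add0r.
  + by move=> t; apply: continuous_comp; [exact: continuous_rV_consl|exact: ck].
  + by move=> t tA /=; apply: (h0 _ ord0); rewrite mxE unlift_none.
  + by move=> t tA /=; apply: (k0 _ ord0); rewrite mxE unlift_none.
Qed.

End rV.

(** * Sobolev regularity of smooth functions *)

Section sobolev.
Context {R : realType} {n : nat}.
Local Notation E := 'rV[R]_n.
Implicit Types (x : E) (v phi : E -> R).

Lemma continuous_enorm : continuous (@enorm R n).
Proof.
move=> x; rewrite /enorm.
apply: (@continuous_comp _ _ _ (fun x : E => \sum_i x ord0 i ^+ 2) Num.sqrt);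
  last exact: sqrt_continuous.
have c2 i : continuous (fun x : E => x ord0 i ^+ 2).
  move=> y; apply: (@continuous_comp _ _ _ (fun x : E => x ord0 i) (fun t => t ^+ 2));
  [exact: continuous_coor|exact: exprn_continuous].
suff : forall s : seq 'I_n,
  continuous (fun x : E => \sum_(i <- s) x ord0 i ^+ 2) by exact.
elim=> [|i s IH].
  by under eq_fun do rewrite big_nil; exact: cst_continuous.
by under eq_fun do rewrite big_cons; move=> y; exact: (cvgD (c2 i y) (IH y)).
Qed.

Lemma enorm_ge0 x : 0 <= enorm x. Proof. exact: sqrtr_ge0. Qed.

Lemma sqr_enorm x : enorm x ^+ 2 = \sum_i x ord0 i ^+ 2.
Proof. by rewrite sqr_sqrtr// sumr_ge0// => i _; exact: sqr_ge0. Qed.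

Lemma enorm0 : enorm (0 : E) = 0.
Proof.
rewrite /enorm big1 ?sqrtr0// => i _.
by rewrite mxE expr0n.
Qed.

Lemma le_coor_enorm x i : `|x ord0 i| <= enorm x.
Proof.
rewrite -ler_sqr ?nnegrE ?enorm_ge0// sqr_enorm real_normK ?num_real//.
by rewrite (bigD1 i)//= lerDl sumr_ge0// => j _; exact: sqr_ge0.
Qed.

Lemma enorm_eq0 x : (enorm x == 0) = (x == 0).
Proof.
apply/eqP/eqP => [x0|->]; last exact: enorm0.
by apply/rowP => i; rewrite mxE; apply/eqP; rewrite -normr_le0 -x0 le_coor_enorm.
Qed.

Lemma unit_cball_box x : enorm x <= 1 -> box (-1) 1 x.
Proof.
by move=> x1 i; rewrite /= in_itv/= -ler_norml (le_trans (le_coor_enorm x i)).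
Qed.

Lemma unit_ball_coor x i : 1 <= `|x ord0 i| -> ~ unit_ball x.
Proof.
move=> xi; rewrite /unit_ball/= => /(le_lt_trans (le_coor_enorm x i)).
by rewrite ltNge xi.
Qed.

Lemma lebesgue_unit_ball_fin : (lebesgue_rV n (@unit_ball R n) < +oo)%E.
Proof.
apply: (@le_lt_trans _ _ (lebesgue_rV n (box (-1) 1))).
  apply: le_measure; rewrite ?inE.
  - exact: measurable_unit_ball.
  - exact: measurable_box.
  - by move=> x /ltW x1; exact: unit_cball_box.
by rewrite lebesgue_box ?ltry//; lra.
Qed.

Lemma measurable_unit_sphere : measurable (@unit_sphere R n).
Proof.
rewrite (_ : unit_sphere = enorm @^-1` [set 1]); last by [].
by rewrite -[X in measurable X]setTI; exact: measurable_enorm.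
Qed.

Lemma surface_unit_sphere_fin :
  (@surface_measure R n (@unit_sphere R n) < +oo)%E.
Proof.
rewrite /surface_measure/= /mscale/= lte_mul_pinfty//.
rewrite /cone_measure /pushforward /mrestr.
apply: le_lt_trans lebesgue_unit_ball_fin.
apply: le_measure; rewrite ?inE; [|exact: measurable_unit_ball|exact: subIsetr].
apply: measurableI; last exact: measurable_unit_ball.
rewrite -[X in measurable X]setTI; apply: measurable_radial_proj => //.
exact: measurable_unit_sphere.
Qed.

Lemma L2_continuous (m : {measure set E -> \bar R}) (D : set E) v :
  measurable D -> (m D < +oo)%E -> D `<=` unit_cball -> continuous v -> L2 m D v.
Proof.
move=> mD Dfin DB cv.
have mv := measurable_continuous_rV cv.
split; first exact: measurable_funTS.
have [C vC] := @bounded_continuous_box R n (-1) 1 v cv.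
rewrite /sq_norm.
apply: (@le_lt_trans _ _ (\int[m]_(x in D) (C ^+ 2)%:E)%E); last first.
  by rewrite integral_cst// lte_mul_pinfty// lee_fin sqr_ge0.
apply: ge0_le_integral => //.
- by move=> x _; rewrite lee_fin sqr_ge0.
- apply/measurable_EFinP; apply: measurable_funX; exact: measurable_funTS.
- move=> x Dx; rewrite lee_fin -[v x ^+ 2]real_normK ?num_real//.
  have := vC x (unit_cball_box (DB x Dx)).
  by move=> vxC; rewrite lerXn2r ?nnegrE// (le_trans _ vxC).
Qed.

Lemma L2_ball_continuous v : continuous v ->
  L2 (lebesgue_rV n) unit_ball v.
Proof.
apply: L2_continuous; [exact: measurable_unit_ball|exact: lebesgue_unit_ball_fin|].
by move=> x /ltW.
Qed.

Lemma L2_sphere_continuous v : continuous v -> L2 surface_measure unit_sphere v.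
Proof.
apply: L2_continuous; [exact: measurable_unit_sphere|exact: surface_unit_sphere_fin|].
by move=> x; rewrite /unit_sphere /unit_cball/= => ->.
Qed.

(** The support is closed and inside the open ball, so [phi] vanishes on a neighbourhood of every
    point outside, the sphere included. *)
Lemma test_function_support phi i x : test_function phi -> ~ unit_ball x ->
  phi x = 0 /\ partial i phi x = 0.
Proof.
move=> [_ _ supp] xB.
have xcl : ~ closure [set x | phi x != 0] x by move=> /supp.
have phi0 : phi x = 0.
  apply: contrapT => /eqP p0; apply: xcl; exact: subset_closure.
split => //.
have nx : \forall y \near x, phi y = 0.
  have := @open_nbhs_nbhs _ x (~` closure [set x | phi x != 0]).
  move=> /(_ (conj (closed_openC (@closed_closure _ _)) xcl)).
  apply: filterS => y ycl; apply: contrapT => /eqP p0.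
  by apply: ycl; exact: subset_closure.
rewrite /partial (@near_eq_derive _ _ _ _ (cst 0)) ?derive_cst//.
Qed.

(** Both integrals extend to the whole space, since [phi] and its derivative vanish off the ball.
    Their sum is the integral of the derivative of [v * phi], which is supported in the ball. *)
Lemma weak_partial_C1 i v (dv : E -> R) : continuous v -> continuous dv ->
  (forall x, is_derive x (delta_mx ord0 i) v (dv x)) -> weak_partial i v dv.
Proof.
move=> cv cdv dvx phi tphi; have [Cphi _ _] := tphi.
have [cphi [dphi cdphi]] := Cphi 1%N.
have {}cdphi : continuous (partial i phi) by have [] := cdphi i.
have mB := @measurable_unit_ball R n.
have int0 (g : E -> R) : continuous g -> (forall x, ~ unit_ball x -> g x = 0) ->
    (lebesgue_rV n).-integrable setT (EFin \o g).
  move=> cg g0.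
  have [C gC] := @bounded_continuous_box R n (-1) 1 g cg.
  apply: (integrable_bounded_support mB lebesgue_unit_ball_fin (C := `|C|)) => //.
    exact: measurable_continuous_rV.
  move=> x; have [xB|xB] := pselect (unit_ball x).
    by rewrite (le_trans (gC x _)) ?ler_norm//; apply: unit_cball_box; exact: ltW.
  by rewrite g0// normr0.
have restrict (g : E -> R) : (forall x, ~ unit_ball x -> g x = 0) ->
    \int[lebesgue_rV n]_(x in unit_ball) g x = \int[lebesgue_rV n]_x g x.
  move=> g0; rewrite Rintegral_mkcond; congr Rintegral.
  apply/funext => x; rewrite patchE; case: ifPn => //.
  by rewrite notin_setE => /g0.
have z1 x : ~ unit_ball x -> v x * partial i phi x = 0.
  by move=> xB; have [_ ->] := test_function_support i tphi xB; rewrite mulr0.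
have z2 x : ~ unit_ball x -> dv x * phi x = 0.
  by move=> xB; have [-> _] := test_function_support i tphi xB; rewrite mulr0.
rewrite !restrict//; apply/eqP; rewrite -addr_eq0; apply/eqP.
rewrite -RintegralD//; [|exact: int0 (continuous_mul cv cdphi) z1|
  exact: int0 (continuous_mul cdv cphi) z2].
pose k x := v x * partial i phi x + dv x * phi x.
have ck : continuous k.
  exact: continuous_add (continuous_mul cv cdphi) (continuous_mul cdv cphi).
have [C kC] := @bounded_continuous_box R n (-1) 1 k ck.
have k0 x : ~ unit_ball x -> k x = 0.
  by move=> xB; rewrite /k z1// z2// addr0.
suff E0 : (\int[lebesgue_rV n]_x (k x)%:E = 0)%E.
  by transitivity (fine (\int[lebesgue_rV n]_x (k x)%:E)); [by []|rewrite E0].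
apply: (@integral_partial_eq0 R n i (fun x => v x * phi x) k 1 `|C|) => //.
- move=> x; have := is_deriveM (dvx x) (DeriveDef (dphi i x) erefl).
  move/is_derive_eq; apply; rewrite /k; congr (_ + _); exact: mulrC.
- move=> x; have [xB|xB] := pselect (unit_ball x).
    by rewrite (le_trans (kC x _)) ?ler_norm//; apply: unit_cball_box; exact: ltW.
  by rewrite k0// normr0.
- move=> x j xj; have [-> _] := test_function_support i tphi (unit_ball_coor xj).
  by rewrite mulr0.
- by move=> x j /unit_ball_coor /k0.
Qed.

Lemma H1_C1 v (dv : 'I_n -> E -> R) : continuous v ->
  (forall i, continuous (dv i)) ->
  (forall i x, is_derive x (delta_mx ord0 i) v (dv i x)) -> H1 v dv.
Proof.
move=> cv cdv dvx; split; first exact: L2_ball_continuous.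
move=> i; split; first exact: L2_ball_continuous.
by apply: weak_partial_C1 => //; exact: dvx.
Qed.

(** The constant sequence [v] is an admissible approximation. *)
Lemma trace_continuous v (dv : 'I_n -> E -> R) :
  continuous v -> H1 v dv -> trace v dv v.
Proof.
move=> cv Hv; split; first exact: L2_sphere_continuous.
have sq0 (m : {measure set E -> \bar R}) D (w : E -> R) :
    sq_norm m D (w \- w) @[_ --> \oo] --> 0%E.
  rewrite (_ : sq_norm m D (w \- w) = 0%E); first exact: cvg_cst.
  rewrite /sq_norm; transitivity (\int[m]_(x in D) (0 : \bar R))%E; last exact: integral0.
  by apply: eq_integral => x _ /=; rewrite subrr expr0n.
exists (fun=> v), (fun=> dv); split => //.
by move=> _; split => //; exact: continuous_subspaceT.
Qed.

End sobolev.

(** * Radial functions *)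

Section radial_function.
Context {R : realType}.

Lemma is_derive_of_quotient (V : normedModType R) (f : V -> R) (x v : V) (d : R) :
  (fun s : R => s^-1 *: (f (s *: v + x) - f x)) @ 0^' --> d -> is_derive x v f d.
Proof. by move=> H; split; [exact: cvgP H|exact: (cvg_lim _ H)]. Qed.

Lemma is_derive_line (V : normedModType R) (f : V -> R) (x v : V) (d : R) :
  is_derive (0 : R) 1 (fun s : R => f (s *: v + x)) d -> is_derive x v f d.
Proof.
move=> [H <-].
have E : (fun s : R => s^-1 *: ((f \o shift x) (s *: v) - f x)) =
    (fun s : R => s^-1 *: (((fun s : R => f (s *: v + x)) \o shift 0) (s *: 1) -
      f (0 *: v + x))).
  by apply/funext => s /=; rewrite addr0 scale0r add0r [s *: 1]mulr1.
by split; rewrite /derivable /derive E.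
Qed.

(** The difference quotient at 0 is [phi] itself, so continuity suffices. This gives the second
    derivatives at the origin, where only the continuity of [V] is known. *)
Lemma is_derive_mul_id (phi : R -> R) : {for 0, continuous phi} ->
  is_derive (0 : R) 1 (fun s => phi s * s) (phi 0).
Proof.
move=> cphi; apply: is_derive_of_quotient.
apply: (@cvg_trans _ (phi @ 0^')); last first.
  by apply: cvg_trans cphi; apply: cvg_app; exact: nbhs_dnbhs.
apply: near_eq_cvg; near=> s.
have s0 : s != 0 by near: s; exact: nbhs_dnbhs_neq.
by rewrite [s *: 1]mulr1 addr0 mulr0 subr0 [RHS]mulrC mulfK.
Unshelve. all: by end_near. Qed.

Variables (n : nat) (h U V : R -> R).
Hypothesis h_continuous : continuous h.
Hypothesis S : radial_system n h U V.
Local Notation E := 'rV[R]_n.+1.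

(** For [r > 0] this is r V' = U'' - U'/r, the radial part of the Hessian. Written without V', it is
    continuous and vanishes at 0. *)
Definition radial_remainder (r : R) := h r - n.+1%:R * V r.

Lemma is_derive_radial_V (r : R) : 0 < r -> is_derive r 1 V (r^-1 * radial_remainder r).
Proof.
move=> r0; have [_ _ _ _ dV] := S.
have rn0 : r ^+ n.+1 != 0 by rewrite expf_neq0// gt_eqF.
have := is_deriveM (dV r r0) 
  (@is_deriveV _ (fun s : R => s ^+ n.+1) _ _ _ rn0 (is_derive_exprS n r)).
move=> /is_derive_eq dd.
have {}dd := dd _ erefl.
apply: near_is_derive (is_derive_eq dd _); last first.
  have p0 : r ^+ n != 0 by rewrite expf_neq0// gt_eqF.
  rewrite /GRing.scale/= exprS /radial_remainder.
  have r00 : r != 0 by rewrite gt_eqF.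
  move: (r ^+ n) p0 => p p0.
  by field; rewrite ?p0 ?r00.
near=> s; have s0 : 0 < s by near: s; exact: lt_nbhsr.
by rewrite !fctE mulrAC divff ?mul1r// expf_neq0// gt_eqF.
Unshelve. all: by end_near. Qed.

Lemma sqr_enorm_line i (s : R) (x : E) :
  enorm (s *: delta_mx ord0 i + x) ^+ 2 =
  enorm x ^+ 2 + 2 * x ord0 i * s + s ^+ 2.
Proof.
rewrite !sqr_enorm (bigD1 i)//= [in RHS](bigD1 i)//= !mxE !eqxx/= mulr1.
rewrite (eq_bigr (fun j => x ord0 j ^+ 2)); last first.
  by move=> j ji; rewrite !mxE eqxx/= (negbTE ji) mulr0 add0r.
by ring.
Qed.

Lemma enorm_line0 i (s : R) : enorm (s *: delta_mx ord0 i + 0 : E) = `|s|.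
Proof.
rewrite -[LHS]ger0_norm ?enorm_ge0// -sqrtr_sqr sqr_enorm_line enorm0 mxE.
by rewrite expr0n/= mulr0 mul0r !add0r sqrtr_sqr.
Qed.

Lemma is_derive_enorm_line i (x : E) : x != 0 ->
  is_derive (0 : R) 1 (fun s : R => enorm (s *: delta_mx ord0 i + x))
    (x ord0 i / enorm x).
Proof.
move=> x0.
have ex0 : 0 < enorm x by rewrite lt_def enorm_eq0 x0 enorm_ge0.
pose p (s : R) := enorm x ^+ 2 + 2 * x ord0 i * s + s ^+ 2.
have dp : is_derive (0 : R) 1 p (2 * x ord0 i).
  have d1 := is_derive_mull (2 * x ord0 i) 0.
  have := is_deriveD (is_deriveD (is_derive_cst (enorm x ^+ 2) (0 : R) 1) d1)
    (is_derive_exprS 1 0).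
  by move/is_derive_eq; apply; rewrite add0r expr1 mulr0 addr0.
have p0 : p 0 = enorm x ^+ 2 by rewrite /p mulr0 expr0n/= !addr0.
have := @is_derive1_comp R Num.sqrt p 0 _ _ (is_derive1_sqrt _) dp.
rewrite p0 exprn_gt0// => /(_ isT) dd.
rewrite (_ : (fun s : R => _) = Num.sqrt \o p); last first.
  by apply/funext => s /=; rewrite /p -sqr_enorm_line sqrtr_sqr ger0_norm ?enorm_ge0.
apply: is_derive_eq dd _.
have e0 : enorm x != 0 by rewrite gt_eqF.
by rewrite sqrtr_sqr ger0_norm ?ltW//; field.
Qed.

(** U' = r V with [V] bounded on [0, 1]. It makes the gradient vanish at the origin, where the
    Euclidean norm is not differentiable. *)
Let radial_quadratic : exists B : R, forall r : R, 0 <= r <= 1 ->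
  `|U r - U 0| <= B * r ^+ 2.
Proof.
have [cU cV _ dU _] := S.
have [B HB] := @bounded_within_itv R V 0 1 (continuous_subspaceT cV).
exists B => r /andP[r0 r1].
have d2 (C x : R) : is_derive x 1 (fun s : R => C * s ^+ 2) (C * (2 * x)).
  exact: is_deriveZ (is_derive_exprS 1 x).
have c2 (C : R) : continuous (fun s : R => C * s ^+ 2).
  by move=> x; apply: cvgM; [exact: cvg_cst|exact: exprn_continuous].
have B0 : 0 <= B by rewrite (le_trans _ (HB 0 _))// lexx ler01.
have VB (x : R) : 0 < x < r -> `|x * V x| <= B * (2 * x).
  move=> /andP[x0 xr]; rewrite normrM gtr0_norm//.
  have := HB x; rewrite (ltW x0) (le_trans (ltW xr))// => /(_ isT) VxB.
  rewrite [leRHS](_ : _ = x * (B + B)); last by ring.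
  by rewrite ler_pM2l// (le_trans VxB)// lerDl.
have h1 := @derivative_le R U (fun s => B * s ^+ 2) (fun s => s * V s)
  (fun s => B * (2 * s)) 0 r r0 cU (c2 B) _ (fun x _ => d2 B x) _.
have h2 := @derivative_le R (fun s => - B * s ^+ 2) U
  (fun s => - B * (2 * s)) (fun s => s * V s) 0 r r0 (c2 (- B)) cU
  (fun x _ => d2 (- B) x) _ _.
rewrite ler_norml; apply/andP; split.
- move: h2; rewrite expr0n/= mulr0 subr0 mulNr; apply.
    by move=> x /andP[x0 _]; exact: dU.
  by move=> x xr; rewrite mulNr; have := VB x xr; rewrite ler_norml => /andP[].
- move: h1; rewrite expr0n/= mulr0 subr0; apply.
    by move=> x /andP[x0 _]; exact: dU.
  by move=> x xr; have := VB x xr; rewrite ler_norml => /andP[].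
Qed.

Lemma is_derive_radial i (x : E) :
  is_derive x (delta_mx ord0 i) (fun x => U (enorm x)) (V (enorm x) * x ord0 i).
Proof.
apply: is_derive_line; have [->|x0] := eqVneq x 0.
  rewrite mxE mulr0 (_ : (fun s : R => _) = fun s : R => U `|s|); last first.
    by apply/funext => s; rewrite enorm_line0.
  have [B UB] := radial_quadratic.
  apply: is_derive_of_quotient; apply/cvgrPdist_le => e e0.
  have B10 : 0 < `|B| + 1 by rewrite ltr_wpDl.
  near=> s.
  have s0 : s != 0 by near: s; exact: nbhs_dnbhs_neq.
  have s1 : `|s| <= 1.
    by near: s; apply: nbhs_dnbhs; apply: filterS (nbhs0_le ltr01).
  have sB : `|s| <= e / (`|B| + 1).
    by near: s; apply: nbhs_dnbhs; apply: filterS (nbhs0_le (divr_gt0 e0 B10)).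
  rewrite sub0r normrN [s *: 1]mulr1 addr0 normr0 normrZ normfV.
  have := UB `|s|; rewrite normr_ge0 s1 => /(_ isT) H.
  rewrite mulrC ler_pdivrMr ?normr_gt0// (le_trans H)// expr2 mulrA ler_wpM2r//.
  rewrite (@le_trans _ _ ((`|B| + 1) * `|s|))//.
    by rewrite ler_wpM2r// (le_trans (ler_norm B))// lerDl.
  by rewrite mulrC -ler_pdivlMr.
have ex0 : 0 < enorm x by rewrite lt_def enorm_eq0 x0 enorm_ge0.
have [_ _ _ dU _] := S.
have dU' : is_derive (enorm (0 *: delta_mx ord0 i + x)) 1 U (enorm x * V (enorm x)).
  by rewrite scale0r add0r; exact: dU.
have := @is_derive1_comp R U (fun s : R => enorm (s *: delta_mx ord0 i + x)) 0 _ _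
  dU' (is_derive_enorm_line i x0).
move/is_derive_eq; apply.
have e0 : enorm x != 0 by rewrite gt_eqF.
by field.
Unshelve. all: by end_near. Qed.

(* At [x = 0] the quotients are [0 / 0 = 0], and the value is the right one,
   [V 0] times the identity. *)
Definition radial_hessian (i j : 'I_n.+1) (x : E) : R :=
  V (enorm x) * (i == j)%:R +
  radial_remainder (enorm x) * (x ord0 i / enorm x) * (x ord0 j / enorm x).

Lemma is_derive_radial_gradient i j (x : E) :
  is_derive x (delta_mx ord0 j) (fun x => V (enorm x) * x ord0 i)
    (radial_hessian i j x).
Proof.
have [_ cV _ _ _] := S.
rewrite /radial_hessian; apply: is_derive_line; have [->|x0] := eqVneq x 0.
  rewrite !mxE enorm0 !mul0r mulr0 addr0.
  rewrite (_ : (fun s : R => _) = fun s : R => (V `|s| * (i == j)%:R) * s); last first.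
    apply/funext => s; rewrite enorm_line0 !mxE eqxx/= addr0.
    by rewrite -mulrA [s * _]mulrC.
  have := @is_derive_mul_id (fun s : R => V `|s| * (i == j)%:R).
  rewrite normr0; apply => /=.
  apply: cvgM; last exact: cvg_cst.
  apply: (@continuous_comp _ _ _ (fun s : R => `|s|) V); first exact: norm_continuous.
  exact: cV.
have ex0 : 0 < enorm x by rewrite lt_def enorm_eq0 x0 enorm_ge0.
have e0 : enorm x != 0 by rewrite gt_eqF.
have dV' : is_derive (enorm (0 *: delta_mx ord0 j + x)) 1 V
    ((enorm x)^-1 * radial_remainder (enorm x)).
  by rewrite scale0r add0r; exact: is_derive_radial_V.
have d1 := @is_derive1_comp R V (fun s : R => enorm (s *: delta_mx ord0 j + x)) 0 _ _
  dV' (is_derive_enorm_line j x0).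
have d2 : is_derive (0 : R) 1
    (fun s : R => (s *: delta_mx ord0 j + x) ord0 i) (i == j)%:R.
  rewrite (_ : (fun s : R => _) = (fun s => (i == j)%:R * s + x ord0 i)); last first.
    by apply/funext => s; rewrite !mxE eqxx/= mulrC.
  have := is_deriveD (is_derive_mull (i == j)%:R 0) (is_derive_cst (x ord0 i) (0 : R) 1).
  by move/is_derive_eq; apply; rewrite addr0.
have := is_deriveM d1 d2; move/is_derive_eq; apply.
rewrite /= scale0r add0r /GRing.scale/=.
by field.
Qed.

Lemma radial_remainder0 : radial_remainder 0 = 0.
Proof.
have [_ _ V0 _ _] := S.
by rewrite /radial_remainder V0 mulrC divfK ?subrr// pnatr_eq0.
Qed.

Let continuous_comp_enorm (phi : R -> R) : continuous phi ->
  continuous (fun x : E => phi (enorm x)).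
Proof.
by move=> cphi x; apply: continuous_comp; [exact: continuous_enorm|exact: cphi].
Qed.

Lemma continuous_radial : continuous (fun x : E => U (enorm x)).
Proof. by have [cU _ _ _ _] := S; exact: continuous_comp_enorm. Qed.

Lemma continuous_radial_gradient i : continuous (fun x : E => V (enorm x) * x ord0 i).
Proof.
have [_ cV _ _ _] := S.
exact: continuous_mul (continuous_comp_enorm cV) (@continuous_coor R _ i).
Qed.

(** The direction cosines have no limit at the origin, but they are bounded by 1 and their
    coefficient [radial_remainder] tends to 0. *)
Lemma continuous_radial_hessian i j : continuous (radial_hessian i j).
Proof.
have [_ cV _ _ _] := S.
have cG : continuous (fun x : E => radial_remainder (enorm x)).
  apply: continuous_comp_enorm => x; apply: cvgB; first exact: h_continuous.
  by apply: cvgM; [exact: cvg_cst|exact: cV].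
have c1 : continuous (fun x : E => V (enorm x) * (i == j)%:R).
  exact: continuous_mul (continuous_comp_enorm cV) (@cst_continuous _ _ _).
move=> x; apply: (cvgD (c1 x)).
have [->|x0] := eqVneq x 0.
  apply/cvgrPdist_le => e e0.
  have : {near (0 : E), forall y,
      `|radial_remainder (enorm (0 : E)) - radial_remainder (enorm y)| <= e}.
    by have /cvgrPdist_le := cG (0 : E); exact.
  apply: filterS => y; rewrite enorm0 radial_remainder0 !mul0r !sub0r !normrN.
  apply: le_trans.
  have le1 k : `|y ord0 k / enorm y| <= 1.
    have [ey0|ey0] := eqVneq (enorm y) 0; first by rewrite ey0 invr0 mulr0 normr0.
    have ey : 0 < enorm y by rewrite lt_def ey0 enorm_ge0.
    by rewrite normrM normfV (gtr0_norm ey) ler_pdivrMr// mul1r le_coor_enorm.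
  rewrite -mulrA normrM ler_piMr// normrM -[leRHS]mulr1 ler_pM//.
have ex0 : enorm x != 0 by rewrite enorm_eq0.
have cq k : (fun y : E => y ord0 k / enorm y) @ x --> x ord0 k / enorm x.
  apply: (cvgM (@continuous_coor R _ k x)).
  by apply: cvgV => //; exact: continuous_enorm.
exact: (cvgM (cvgM (cG x) (cq i)) (cq j)).
Qed.

(** Off the origin the squared direction cosines add up to 1, which leaves (n+1) V + (h - (n+1) V).
    At the origin the remainder is 0 and [V 0 = h 0 / n.+1%:R]. *)
Lemma radial_laplacian (x : E) : \sum_i radial_hessian i i x = h (enorm x).
Proof.
have [_ _ V0 _ _] := S.
rewrite /radial_hessian big_split/= -mulr_sumr.
rewrite [X in _ * X + _](eq_bigr (fun=> 1)) => [|i _]; last by rewrite eqxx.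
rewrite sumr_const card_ord.
have [->|x0] := eqVneq x 0.
  rewrite enorm0 radial_remainder0 big1 => [|i _]; last by rewrite !mul0r.
  by rewrite addr0 V0 divfK// pnatr_eq0.
have ex0 : enorm x != 0 by rewrite enorm_eq0.
under eq_bigr do rewrite -mulrA -expr2 expr_div_n.
rewrite -mulr_sumr -mulr_suml -sqr_enorm divff ?expf_neq0//.
by rewrite mulr1 /radial_remainder addrC mulrC subrK.
Qed.

Lemma radial_H2 : H2 (fun x : E => U (enorm x)) (fun i x => V (enorm x) * x ord0 i)
  radial_hessian.
Proof.
split => [|i].
  apply: H1_C1; [exact: continuous_radial|exact: continuous_radial_gradient|].
  exact: is_derive_radial.
apply: H1_C1; [exact: continuous_radial_gradient|exact: continuous_radial_hessian|].
exact: is_derive_radial_gradient.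
Qed.

Lemma radial_neumann : V 1 = 0 ->
  neumann (fun i (x : E) => V (enorm x) * x ord0 i) radial_hessian.
Proof.
move=> V1; exists (fun i (x : E) => V (enorm x) * x ord0 i); split.
  move=> i; apply: trace_continuous; first exact: continuous_radial_gradient.
  by have [_] := radial_H2; apply.
apply: aeW => x; rewrite /unit_sphere/= => ->.
by rewrite big1// => i _; rewrite V1 mul0r mulr0.
Qed.

End radial_function.

(** * Truncation of the data and conclusion *)

Section clamp.
Context {R : realType}.
Implicit Types (b s t : R) (f : R -> R) (A : set R).

Definition clamp b t : R := Num.max 0 (Num.min t b).

Lemma clamp_itv b t : 0 <= b -> 0 <= clamp b t <= b.
Proof. by move=> b0; rewrite /clamp le_max lexx/= ge_max b0 ge_min lexx orbT. Qed.

Lemma clamp_id b t : 0 <= t <= b -> clamp b t = t.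
Proof. by move=> /andP[t0 tb]; rewrite /clamp (min_idPl tb) (max_idPr t0). Qed.

Lemma clamp_le0 b t : t <= 0 -> clamp b t = 0.
Proof. by move=> t0; apply/max_idPl; rewrite ge_min t0. Qed.

Lemma clamp_nd b : {homo clamp b : s t / s <= t}.
Proof.
move=> s t st; rewrite /clamp ge_max le_max lexx/= le_max; apply/orP; right.
by rewrite le_min !ge_min st lexx orbT.
Qed.

Lemma dist_clamp b s t : 0 <= b -> `|clamp b s - clamp b t| <= `|s - t|.
Proof.
move=> b0; wlog st : s t / s <= t.
  by move=> H; have [/H//|/ltW/H] := leP s t; rewrite distrC [leRHS]distrC.
rewrite distrC [leRHS]distrC !ger0_norm ?subr_ge0 ?clamp_nd//.
rewrite /clamp; have [?|?] := leP t b; have [?|?] := leP s b;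
  have [?|?] := leP 0 t; have [?|?] := leP 0 s; have [?|?] := leP 0 b; lra.
Qed.

Lemma quotient_near A f (x l e : R) :
  (f y - f x) / (y - x) @[y --> within A x^'] --> l -> 0 < e ->
  exists2 d : R, 0 < d & forall y : R, `|x - y| < d -> y != x -> A y ->
    `|l - (f y - f x) / (y - x)| <= e.
Proof.
move=> /cvgrPdist_le H e0; have {H}H := H e e0.
have : nbhs x (fun y => y != x -> A y -> `|l - (f y - f x) / (y - x)| <= e) by exact: H.
by move=> /nbhs_ballP[d d0 Hd]; exists d => // y yx; exact: Hd.
Qed.

(** Difference quotients within [A] that converge are bounded near the point, which gives a
    Lipschitz estimate there; [clamp] is 1-Lipschitz with values in [A]. *)
Lemma continuous_clamp A f b : 0 <= b -> (forall t, 0 <= t <= b -> A t) ->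
  C1_on A f -> continuous (fun t => f (clamp b t)).
Proof.
move=> b0 bA [df [_ dfP]] x; set p := clamp b x.
have pA : A p by apply: bA; exact: clamp_itv.
have [d d0 Hd] := quotient_near (dfP p pA) ltr01.
have K0 : 0 < `|df p| + 1 by rewrite ltr_wpDl.
have lip y : `|p - y| < d -> A y -> `|f p - f y| <= (`|df p| + 1) * `|p - y|.
  move=> pyd Ay; have [->|yp] := eqVneq y p; first by rewrite !subrr normr0 mulr0.
  have := Hd y pyd yp Ay; rewrite distrC => H.
  have : `|(f y - f p) / (y - p)| <= `|df p| + 1.
    rewrite -[_ / _](subrK (df p)) (le_trans (ler_normD _ _))// addrC lerD2l//.
  rewrite normrM normfV ler_pdivrMr ?normr_gt0 ?subr_eq0//.
  by rewrite distrC [`|y - p|]distrC.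
apply/cvgrPdist_le => e e0; near=> t.
have xt : `|p - clamp b t| <= `|x - t| by exact: dist_clamp.
have td : `|p - clamp b t| < d.
  by rewrite (le_lt_trans xt)//.
rewrite (le_trans (lip _ td _))//; first by apply: bA; exact: clamp_itv.
rewrite mulrC -ler_pdivlMr// (le_trans xt)//; near: t.
by have /cvgrPdist_le := @cvg_id _ (nbhs x); apply; rewrite divr_gt0.
Unshelve. all: by end_near. Qed.

Lemma dist_le_derivative f (df : R -> R) (L s t : R) : s <= t -> continuous f ->
  (forall x : R, s < x < t -> is_derive x 1 f (df x)) ->
  (forall x : R, s < x < t -> `|df x| <= L) ->
  `|f t - f s| <= L * (t - s).
Proof.
move=> st cf dfx dfL.
have cc (c : R) := is_derive_continuous (is_derive_mull c).
have dl (x : R) : s < x < t -> - L <= df x.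
  by move=> /dfL; rewrite ler_norml => /andP[].
have dr (x : R) : s < x < t -> df x <= L.
  by move=> /dfL; rewrite ler_norml => /andP[].
rewrite ler_norml; apply/andP; split.
  rewrite -mulNr mulrBr.
  exact: (@derivative_le R (fun y => - L * y) f (fun=> - L) df s t st (cc (- L)) cf
    (fun x _ => is_derive_mull (- L) x) dfx dl).
rewrite mulrBr.
exact: (@derivative_le R f (fun y => L * y) df (fun=> L) s t st cf (cc L) dfx
  (fun x _ => is_derive_mull L x) dr).
Qed.

(** The derivative is bounded on the compact [0, b], and the mean value inequality applies there;
    idempotence of [clamp] reduces arbitrary arguments to that interval. *)
Lemma lipschitz_clamp f b : 0 < b -> C1_on `[0, +oo[ f ->
  exists2 L : R, 0 <= L &
    forall y z, `|f (clamp b y) - f (clamp b z)| <= L * `|y - z|.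
Proof.
move=> b0 fC1; have cF : continuous (fun t => f (clamp b t)).
  apply: (continuous_clamp (ltW b0) _ fC1) => t /andP[t0 _].
  by rewrite /= in_itv/= t0.
have [df [cdf dfP]] := fC1.
have [L HL] : exists L : R, forall t : R, 0 <= t <= b -> `|df t| <= L.
  have cdf' : {within `[0, b], continuous df}.
    by apply: continuous_subspaceW cdf => t /=; rewrite !in_itv/= => /andP[->].
  exact: bounded_within_itv cdf'.
have L0 : 0 <= L by rewrite (le_trans _ (HL 0 _))// lexx ltW.
have dF t : t \in `]0, b[ -> is_derive t 1 (fun t => f (clamp b t)) (df t).
  rewrite in_itv/= => /andP[t0 tb].
  apply: (near_is_derive (f := f)).
    near=> s; rewrite clamp_id//; apply/andP; split; apply/ltW; near: s.
      exact: lt_nbhsr.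
    exact: lt_nbhsl.
  apply: is_derive_of_quotient; apply/cvgrPdist_le => e e0.
  have tA : `[0, +oo[%classic t by rewrite /= in_itv/= ltW.
  have [d d0 Hd] := quotient_near (dfP t tA) e0.
  near=> s.
  have s0 : s != 0 by near: s; exact: nbhs_dnbhs_neq.
  have sd : `|s| < d.
    by near: s; apply: nbhs_dnbhs; apply: filterS (nbhs0_lt d0).
  (* This keeps [t + s] in the half-line, so the quotient within it is the ordinary two-sided
     one. *)
  have st : `|s| < t.
    by near: s; apply: nbhs_dnbhs; apply: filterS (nbhs0_lt t0).
  have := Hd (s *: 1 + t); rewrite addrK [s *: 1]mulr1 [s + t]addrC opprD addNKr normrN.
  have ts : t + s != t by rewrite -subr_eq0 addrAC subrr add0r.
  rewrite [s^-1 *: _]mulrC => /(_ sd ts); apply.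
  rewrite /= in_itv/= andbT -lerBlDl sub0r.
  by move: st => /ltW; rewrite ler_norml => /andP[].
have main (y z : R) : 0 <= y -> y < z -> z <= b ->
    `|f (clamp b y) - f (clamp b z)| <= L * `|y - z|.
  move=> y0 yz zb.
  rewrite distrC [`|y - z|]distrC (gtr0_norm (_ : 0 < z - y)) ?subr_gt0//.
  apply: (@dist_le_derivative (fun t => f (clamp b t)) df) => //.
  - by rewrite ltW.
  - move=> x /andP[yx xz]; apply: dF.
    by rewrite in_itv/= (le_lt_trans y0 yx) (lt_le_trans xz zb).
  - move=> x /andP[yx xz]; apply: HL.
    by rewrite (le_trans y0 (ltW yx)) (le_trans (ltW xz) zb).
exists L => // y z.
apply: (@le_trans _ _ (L * `|clamp b y - clamp b z|)); last first.
  by rewrite ler_wpM2l// dist_clamp// ltW.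
have idem t : clamp b (clamp b t) = clamp b t by rewrite clamp_id// clamp_itv// ltW.
have /andP[y0 yb] := clamp_itv y (ltW b0); have /andP[z0 zb] := clamp_itv z (ltW b0).
rewrite -{1}(idem y) -{1}(idem z); have [yz|zy|->] := ltgtP (clamp b y) (clamp b z).
- exact: main.
- by rewrite distrC [`|clamp b y - _|]distrC; exact: main.
- by rewrite !subrr normr0 mulr0.
Unshelve. all: by end_near. Qed.

End clamp.

(** * Strictly increasing radial profiles are not almost everywhere constant *)

Section nonconstant.
Context {R : realType} {n : nat}.

Lemma sqr_enorm_box (a b : R) (x : 'rV[R]_n) : 0 <= a -> box a b x ->
  n%:R * a ^+ 2 <= enorm x ^+ 2 <= n%:R * b ^+ 2.
Proof.
move=> a0 xab; rewrite sqr_enorm.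
have E (c : R) : n%:R * c ^+ 2 = \sum_(i < n) c ^+ 2.
  by rewrite sumr_const card_ord mulr_natl.
rewrite !E; apply/andP; split; apply: ler_sum => i _;
  have := xab i; rewrite /= in_itv/= => /andP[ax xb].
  by rewrite lerXn2r ?nnegrE// (le_trans a0).
by rewrite lerXn2r ?nnegrE// (le_trans a0)// (le_trans ax).
Qed.

Lemma box_meets_conull (a b : R) (N : set 'rV[R]_n) : a < b -> measurable N ->
  lebesgue_rV n N = 0%E -> exists2 x, box a b x & ~ N x.
Proof.
move=> ab mN N0; apply: contrapT => H.
have : (lebesgue_rV n (box a b) <= lebesgue_rV n N)%E.
  apply: le_measure; rewrite ?inE//; first exact: measurable_box.
  by move=> x xab; apply: contrapT => Nx; apply: H; exists x.
move=> H1; have : (((b - a) ^+ n)%:E <= 0%:E)%E.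
  by rewrite -(lebesgue_box n (ltW ab)) (le_trans H1)// N0.
rewrite lee_fin leNgt => /negP; apply.
by rewrite exprn_gt0// subr_gt0.
Qed.

(** Two cubes of positive measure in the ball, [0, e]^n and [2e, 3e]^n, are separated by the norm.
    Each has a point off the null set, and [U] takes different values at their norms. *)
Lemma increasing_radial_not_ae_constant (U : R -> R) : (0 < n)%N ->
  (forall s t : R, 0 <= s -> s < t -> t < 1 -> U s < U t) ->
  ~ ae_constant (fun x : 'rV[R]_n => U (enorm x)).
Proof.
move=> n0 Uinc [c [N [mN N0 HN]]].
have cU x : ~ N x -> enorm x < 1 -> U (enorm x) = c.
  by move=> Nx x1; apply: contrapT => H; apply: Nx; apply: HN => /(_ x1).
have nR : 1 <= n%:R :> R by rewrite ler1n.
have nR0 : 0 < n%:R :> R by rewrite ltr0n.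
(* The far cube must lie in the ball: 9 n e^2 = (9/4) e <= 9/16 < 1. *)
pose e : R := (4 * n%:R)^-1.
have e0 : 0 < e by rewrite invr_gt0 mulr_gt0.
have ne : n%:R * e = 4^-1 by rewrite /e invfM mulrCA divff ?mulr1// gt_eqF.
have e4 : e <= 4^-1 by rewrite -ne ler_peMl// ltW.
have [x xb Nx] := box_meets_conull e0 mN N0.
have e23 : 2 * e < 3 * e by rewrite ltr_pM2r// ltr_nat.
have [y yb Ny] := box_meets_conull e23 mN N0.
have /andP[_ xle] := sqr_enorm_box (lexx 0) xb.
have /andP[yge yle] := sqr_enorm_box (mulr_ge0 (ler0n _ 2) (ltW e0)) yb.
have xy : enorm x < enorm y.
  rewrite -ltr_sqr ?nnegrE ?enorm_ge0// (le_lt_trans xle)// (lt_le_trans _ yge)//.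
  by rewrite ltr_pM2l// ltrXn2r ?nnegrE ?mulr_ge0 ?ltW// ltr_pMl// ltr1n.
have y1 : enorm y < 1.
  rewrite -ltr_sqr ?nnegrE ?enorm_ge0// expr1n (le_lt_trans yle)//.
  rewrite [ltLHS](_ : _ = 9 * (n%:R * e) * e); last by ring.
  by rewrite ne; lra.
have := Uinc _ _ (enorm_ge0 x) xy y1.
by rewrite !cU// ?ltxx// (lt_trans xy).
Qed.

End nonconstant.

(** * Reduction to the truncated problem and assembly of the solution *)

Theorem theorem1p1 (R : realType) (N : nat) (hN : (2 <= N)%N)
  (a : R -> R) (a_C1 : C1_on `[0, 1] a)
  (a_nd : {in `[0, 1] &, {homo a : r s / r <= s}})
  (a0_gt0 : 0 < a 0)
  (a_nonconst : ~ exists c, forall x : 'rV[R]_N,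
     unit_ball x -> a (enorm x) = c)
  (f : R -> R) (f_C1 : C1_on `[0, +oo[ f)
  (f_nd : {in `[0, +oo[ &, {homo f : s t / s <= t}})
  (f0 : f 0 = 0)
  (df0 : f s / s @[s --> 0^'+] --> 0)
  (f_superlin :
     (((a 0)^-1)%:E < limf_einf (fun s => (f s / s)%:E) (pinfty_nbhs R))%E) :
  exists u : 'rV[R]_N -> R,
    [/\ solution a f u, ~ ae_constant u & radial_nondecreasing u].
Proof.
case: N hN a_nonconst => [//|n] _ a_nonconst.
have [M M0 fM] : exists2 M : R, 0 < M & M < a 0 * f M.
  move: f_superlin; rewrite /limf_einf lteNr -EFinN.
  (* The lower limit is minus the upper limit of -f(s)/s, an infimum of suprema: some neighbourhood
     [W] of infinity has supremum below -1/a(0), and any positive point of it can serve as [M]. *)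
  move=> /ereal_inf_lt[_ [W [m [_ mW]] <-]] supW.
  pose M := Num.max m 0 + 1.
  have M0 : 0 < M by rewrite ltr_wpDl// le_max lexx orbT.
  exists M => //.
  have WM : W M by apply: mW; rewrite ltr_pwDr// le_max lexx.
  have : (- (f M / M)%:E < (- (a 0)^-1)%:E)%E.
    by rewrite (le_lt_trans _ supW)//; apply: ereal_sup_ubound; exists M.
  by rewrite -EFinN lte_fin ltrN2 ltr_pdivlMr// mulrC ltr_pdivrMr// mulrC.
pose K : R := 2 * M * weight 1 1.
have W1 : 1 <= weight 1 1 :> R by exact: weight_ge1.
have MK : M <= K.
  rewrite /K (@le_trans _ _ (2 * M))//; first by rewrite ler_peMl ?ltW// ltr1n.
  by rewrite ler_peMr// mulr_ge0// ltW.
have K0 : 0 < K := lt_le_trans M0 MK.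
(* [K] bounds the solutions with initial value at most [M] whatever the
   truncation of [f], hence [F] can be replaced by [f] at the end. *)
pose A t := a (clamp 1 t).
pose F s := f (clamp K s).
have in01 (t : R) : 0 <= t <= 1 -> t \in `[0, 1] by rewrite in_itv.
have in0y (t : R) : 0 <= t -> t \in `[0, +oo[ by move=> t0; rewrite in_itv/= t0.
have A0E : A 0 = a 0 by rewrite /A clamp_id// lexx ler01.
have A_nd : {homo A : s t / s <= t}.
  move=> s t st; apply: a_nd; [exact/in01/clamp_itv|exact/in01/clamp_itv|].
  exact: clamp_nd.
have A_gt0 t : 0 < A t.
  have [t0|t0] := leP 0 t; last by rewrite /A clamp_le0// ltW.
  by rewrite (lt_le_trans a0_gt0)// -A0E A_nd.
have A_le1 t : A t <= A 1.
  apply: a_nd; [exact/in01/clamp_itv|exact/in01/clamp_itv|].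
  by rewrite (@clamp_id _ _ 1) ?ler01 ?lexx//; have /andP[] := clamp_itv t ler01.
have A_cont : continuous A.
  by apply: (continuous_clamp ler01 _ a_C1) => t t01; exact: in01.
have clampK_ge0 s : 0 <= clamp K s by have /andP[] := clamp_itv s (ltW K0).
have F_nd : {homo F : s t / s <= t}.
  by move=> s t st; apply: f_nd; [exact: in0y|exact: in0y|exact: clamp_nd].
have F_le0 s : s <= 0 -> F s = 0 by move=> s0; rewrite /F clamp_le0.
have [L L0 F_lip] := lipschitz_clamp K0 f_C1.
have A_nonconst : exists2 r : R, 0 <= r < 1 & A r != A 0.
  apply: contrapT => H; apply: a_nonconst; exists (a 0) => x x1.
  have xE : A (enorm x) = a (enorm x) by rewrite /A clamp_id// enorm_ge0 ltW.
  apply/eqP; rewrite -xE -A0E; apply/negP => /negP Ax.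
  by apply: H; exists (enorm x) => //; rewrite enorm_ge0.
have F_small : exists2 s0 : R, 0 < s0 & forall s : R, 0 < s <= s0 -> A 1 * F s < s.
  have A1 : 0 < (A 1)^-1 by rewrite invr_gt0.
  have /cvgrPdist_lt /(_ _ A1) := df0.
  (* Half of [d], because the estimate holds for s < d while [s0] itself is to be included. *)
  move=> [d /= d0 Hd]; exists (d / 2); first by rewrite divr_gt0.
  move=> s /andP[s0 sd].
  have sds : s < d by rewrite (le_lt_trans sd)// ltr_pdivrMr// ltr_pMr// ltr1n.
  have := Hd s; rewrite /= sub0r normrN gtr0_norm// => /(_ sds s0).
  rewrite sub0r normrN => /(le_lt_trans (ler_norm _)) H.
  have Fs : F s <= f s.
    by apply: f_nd; [exact: in0y|exact/in0y/ltW|rewrite /clamp ge_max ltW//= ge_min lexx].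
  rewrite mulrC -ltr_pdivlMr// (le_lt_trans Fs)//.
  by rewrite -ltr_pdivrMl// mulrC.
have F_large : M < A 0 * F M.
  by rewrite A0E /F clamp_id// ltW.
have [U [V [S /andP[U0 _] V1 Vpos Ule]]] := shooting n A_nd A_gt0 F_nd F_le0
  A_nonconst A_cont A_le1 L0 F_lip F_small M0 F_large.
have [cU cV _ dU _] := S.
have cF : continuous F.
  by apply: (continuous_clamp (ltW K0) _ f_C1) => t /andP[t0 _]; exact: in0y.
have ch : continuous (source A F U).
  move=> x; apply: cvgB; first exact: cU.
  apply: cvgM; first exact: A_cont.
  exact: (continuous_comp (cU x) (@cF (U x))).
have Uinc (s t : R) : 0 <= s -> s < t -> t < 1 -> U s < U t.
  move=> s0 st t1.
  have [x||c] := @MVT R U (fun r => r * V r) s t st.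
  - by rewrite in_itv/= => /andP[sx _]; apply: dU; exact: le_lt_trans sx.
  - exact: continuous_subspaceT.
  rewrite in_itv/= => /andP[sc ct] E.
  have c0 := le_lt_trans s0 sc.
  rewrite -subr_gt0 E !mulr_gt0 ?subr_gt0// Vpos// (ltW c0)/=.
  exact: lt_trans t1.
have Upos (r : R) : 0 <= r < 1 -> 0 < U r.
  move=> /andP[]; rewrite le_eqVlt => /predU1P[<- //|r0 r1].
  by rewrite (lt_trans U0)// Uinc.
exists (fun x => U (enorm x)); split.
- exists (fun i x => V (enorm x) * x ord0 i), (radial_hessian (source A F U) V).
  split.
  + exact: radial_H2.
  + apply: aeW => x x1; have x01 : 0 <= enorm x <= 1 by rewrite enorm_ge0 ltW.
    rewrite (radial_laplacian S) /source opprB subrK /A (clamp_id x01) /F clamp_id//.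
    by rewrite Ule// andbT ltW// Upos// enorm_ge0.
  + by move=> x x1; apply: Upos; rewrite enorm_ge0.
  + exact: (radial_neumann ch S V1).
- exact: increasing_radial_not_ae_constant.
- exists U; split => // s t; rewrite !in_itv/= => /andP[s0 _] /andP[_ t1].
  by rewrite le_eqVlt => /predU1P[->//|st]; apply/ltW/Uinc.
Qed.
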